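(* Let $\mathcal{A}$ be a Følner sequence on $G$. For each $1\le p<\infty$, the space $Ap\text{-}Bes^p_{\mathcal{A}}(G)/\equiv$ of Besicovitch $p$-almost periodic functions with respect to $\mathcal{A}$, modulo functions of vanishing seminorm $\|\cdot\|_{\mathsf{B},p,\mathcal{A}}$, equipped with the norm induced by $\|\cdot\|_{\mathsf{B},p,\mathcal{A}}$, is a Banach space.
   Context: $G$ is a locally compact (Hausdorff), $\sigma$-compact abelian group with Haar measure $\theta_G$; $|A|=\theta_G(A)$, and $\mathrm{d}t$ denotes integration against $\theta_G$. A Følner sequence $\mathcal{A}=(A_n)$ on $G$ is a sequence of measurable, pre-compact sets of positive measure such that $\lim_{n\to\infty}|A_n\triangle(t+A_n)|/|A_n|=0$ for all $t\in G$. For $1\le p<\infty$, $\mathcal{L}^p_{loc}(G)$ is the space of measurable $f:G\to\mathbb{C}$ with $\int_K|f(t)|^p\,\mathrm{d}t<\infty$ for all compact $K\subseteq G$. For $f\in\mathcal{L}^p_{loc}(G)$ put $\|f\|_{\mathsf{B},p,\mathcal{A}}=\limsup_{n\to\infty}\big(\frac{1}{|A_n|}\int_{A_n}|f(t)|^p\,\mathrm{d}t\big)^{1/p}$. A function $f\in\mathcal{L}^p_{loc}(G)$ is Besicovitch $p$-almost periodic with respect to $\mathcal{A}$ if for each $\varepsilon>0$ there is a trigonometric polynomial $P$ (finite complex linear combination of continuous characters of $G$) with $\|f-P\|_{\mathsf{B},p,\mathcal{A}}<\varepsilon$; the set of these functions is $Ap\text{-}Bes^p_{\mathcal{A}}(G)$.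 Functions $f,g$ in it are identified, written $f\equiv g$, if $\|f-g\|_{\mathsf{B},p,\mathcal{A}}=0$. *)

(* Defs.v *)
From HB Require Import structures.
From mathcomp Require Import all_boot all_order all_algebra.
From mathcomp Require Import all_classical all_reals all_analysis.
From mathcomp Require Export complex.
Export numFieldNormedType.Exports.

Set Implicit Arguments.
Unset Strict Implicit.
Unset Printing Implicit Defensive.

Import Order.TTheory GRing.Theory Num.Theory.
Local Open Scope classical_set_scope.
Local Open Scope complex_scope.
Local Open Scope ring_scope.

(* A copy of [T] pointed at 0: [topologicalZmodType] does not inherit from
   [pointedType], over which the library builds generated sigma-algebras. *)
Definition pointed0 (T : topologicalZmodType) : Type := T.
HB.instance Definition _ (T : topologicalZmodType) :=
  TopologicalZmodule.on (pointed0 T).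
HB.instance Definition _ (T : topologicalZmodType) :=
  isPointed.Build (pointed0 T) 0.

Notation borel T :=
  (g_sigma_algebraType (@open T : set (set (pointed0 T)))) (only parsing).

Definition sigma_compact (T : topologicalType) (X : set T) :=
  exists2 K : (set T)^nat, forall n, compact (K n) & X = \bigcup_n K n.

Definition translate (G : zmodType) (t : G) (X : set G) : set G :=
  [set t + x | x in X].

Section besicovitch.
Variables (R : realType) (G : topologicalZmodType).
Variable mu : {measure set (borel G) -> \bar R}.
Local Notation C := (R[i]^o).
Local Notation normc := ComplexField.Normc.normc.

(* The regularity clauses are not automatic when [G] is not second countable. *)
Definition haar_measure :=
  [/\ mu [set: G] != 0%E,
      forall (t : G) (B : set (borel G)), measurable B ->
        mu (translate t B) = mu B,
      forall K : set G, compact K -> (mu K < +oo)%E,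
      forall B : set (borel G), measurable B ->
        mu B = ereal_inf [set mu U | U in [set U : set G | open U /\ B `<=` U]]
    & forall U : set G, open U ->
        mu U =
          ereal_sup [set mu K | K in [set K : set G | compact K /\ K `<=` U]]].

Definition folner (A : (set G)^nat) :=
  [/\ forall n, measurable (A n : set (borel G)),
      forall n, precompact (A n),
      forall n, (0 < mu (A n))%E
    & forall t : G,
        (mu (A n `+` translate t (A n)) / mu (A n))%E @[n --> \oo] --> 0%E].

(* [C] carries no sigma-algebra in the library; measurability is Borel
   measurability for the norm topology of [R[i]^o]. *)
Definition Lp_loc (p : R) : set (G -> C) :=
  [set f | measurable_fun [set: borel G] (f : borel G -> borel C) /\
    forall K : set G, compact K ->
      (\int[mu]_(t in (K : set (borel G))) (normc (f t) `^ p)%:E < +oo)%E].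

Definition bes_norm (p : R) (A : (set G)^nat) (f : G -> C) : \bar R :=
  limn_esup (fun n =>
    ((mu (A n))^-1 *
     \int[mu]_(t in (A n : set (borel G))) (normc (f t) `^ p)%:E) `^ p^-1)%E.

Definition character (chi : G -> C) :=
  [/\ continuous chi, forall t, normc (chi t) = 1
    & forall s t, chi (s + t) = chi s * chi t].

Definition trig_poly (P : G -> C) :=
  exists (n : nat) (c : 'I_n -> C) (chi : 'I_n -> G -> C),
    (forall i, character (chi i)) /\
    (forall t, P t = \sum_(i < n) c i * chi i t).

Definition ap_bes (p : R) (A : (set G)^nat) : set (G -> C) :=
  [set f | Lp_loc p f /\
    forall e : R, 0 < e ->
      exists2 P, trig_poly P & (bes_norm p A (fun t => f t - P t)%R < e%:E)%E].

Definition bes_class (p : R) (A : (set G)^nat) (f : G -> C) : set (G -> C) :=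
  [set g | ap_bes p A g /\ bes_norm p A (fun t => f t - g t) = 0%E].

Definition ap_bes_quot (p : R) (A : (set G)^nat) : Type :=
  set_type [set bes_class p A f | f in ap_bes p A].

Definition rep (p : R) (A : (set G)^nat) (x : ap_bes_quot p A)
  : set (G -> C) := sval x.

(* [c] is a complete normed space structure on the type [ap_bes_quot p A]
   itself; the clauses determine its addition, scaling and norm. As in every
   normed module over [R[i]], the norm takes its values in [R[i]]. *)
Definition ap_bes_quot_is_banach (p : R) (A : (set G)^nat) :=
  exists c : CompleteNormedModule.axioms_ R[i] (ap_bes_quot p A),
    let V := CompleteNormedModule.Pack c : completeNormedModType R[i] in
    [/\ forall (x y : V) (f g : G -> C),
          rep x f -> rep y g -> rep (x + y : V) (fun t => f t + g t),
        forall (a : R[i]) (x : V) (f : G -> C),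
          rep x f -> rep (a *: x : V) (fun t => a * f t)
      & forall (x : V) (f : G -> C), rep x f ->
          bes_norm p A f \is a fin_num /\ `|x| = (fine (bes_norm p A f))%:C].

End besicovitch.

(* Main.v *)
Require Import Defs.
From HB Require Import structures.
From mathcomp Require Import finmap.
From mathcomp Require Import all_boot all_order all_algebra.
From mathcomp Require Import all_classical all_reals all_analysis.
From mathcomp Require Import measurable_realfun ring lra.

(* Trigonometric polynomials are dense, so a Cauchy sequence may be replaced by
   trigonometric polynomials P_k with ||P_(k+1) - P_k|| < 4^-k. The key fact is
   that a Folner sequence exhausts the volume: liminf |A_n| >= |K| for every
   compact K. If |G| = oo, then |A_n| -> oo, bounded functions on sets of finite
   measure are negligible, and the limit is glued as f = P_k on B_k \ B_(k-1)
   for a slowly growing compact exhaustion B_k containing the first A_n's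
   (Marcinkiewicz). If |G| < oo, then |A_n| -> |G|, so the seminorm of a
   trigonometric polynomial controls its L^p norm on G and the limit is the
   pointwise one, as in Riesz-Fischer. *)

Set Implicit Arguments.
Unset Strict Implicit.
Unset Printing Implicit Defensive.
Import Order.TTheory GRing.Theory Num.Theory.
Local Open Scope classical_set_scope.
Local Open Scope complex_scope.
Local Open Scope ring_scope.

Local Notation normc := ComplexField.Normc.normc.
Local Notation Re := complex.Re.
Local Notation Im := complex.Im.

(** * Complex-valued measurable functions *)

Section complex_modulus.
Variable R : realType.
Implicit Types z w : R[i].

(** Why the volume is exhausted: integrating |A_n ∩ (A_n - t)| over t in K gives about |K| |A_n| by
    almost invariance, while exchanging the integrals turns it into the integral over s in A_n of
    |(s + K) ∩ A_n|, at most |A_n|^2. Hence |K| <= |A_n| up to a vanishing error. The exchange is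
    the obstacle, since G need not be second countable; it is replaced by an inequality with room to
    spare, between a compact B inside A_n and an open U around A_n that regularity makes almost as
    small. Trigonometric polynomials enter because they are bounded on all of G, whereas a general
    member of the space is only locally integrable. Boundedness makes early pieces of the glued
    function negligible in infinite volume, and in finite volume it controls the integral over the
    part of G that A_n misses. The rate 4^-k is twice geometric: one factor 2^-k pays for the
    weights 2^k on the increments |P_(k+1) - P_k|, the other keeps the weighted series summable. *)

Lemma normc_ge0 z : 0 <= normc z.
Proof. by case: z => a b; exact: sqrtr_ge0. Qed.

Lemma normcD z w : normc (z + w) <= normc z + normc w.
Proof. exact: le_normcD. Qed.

Lemma normcN z : normc (- z) = normc z.
Proof. exact: (@normcN R). Qed.

Lemma normc_distC z w : normc (z - w) = normc (w - z).
Proof. by rewrite -normcN opprB. Qed.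

Lemma normc_Re z : `|Re z| <= normc z.
Proof. by rewrite -lecR; exact: normc_ge_Re. Qed.

Lemma normc_Im z : `|Im z| <= normc z.
Proof.
by case: z => a b /=; rewrite -sqrtr_sqr ler_wsqrtr// lerDr sqr_ge0.
Qed.

Lemma normc_le_ReIm z : normc z <= `|Re z| + `|Im z|.
Proof.
case: z => a b /=; rewrite -[leRHS]ger0_norm ?addr_ge0// -sqrtr_sqr.
rewrite ler_wsqrtr// sqrrD !real_normK ?num_real//.
by rewrite addrAC lerDl mulrn_wge0// mulr_ge0.
Qed.

Lemma normc_normr z : `|z| = (normc z)%:C :> R[i].
Proof. by []. Qed.

End complex_modulus.

Section complex_topology.
Variable R : realType.
Local Notation C := (R[i]^o).

(** Balls of [C] have radii in [R[i]]; a positive element of [R[i]] is real, so radii in [R]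
    suffice. *)
Lemma complex_nbhsP (z : C) (U : set C) :
  nbhs z U <-> exists2 e : R, 0 < e & [set w | normc (z - w) < e] `<=` U.
Proof.
split=> [/nbhs_ballP[e e0 eU]|[e e0 eU]].
  have eE : e = (Re e)%:C by rewrite RRe_real// gtr0_real.
  exists (Re e); first by rewrite -ltcR -eE.
  by move=> w /= zw; apply: eU; rewrite -ball_normE/= eE -ltcR in zw *.
apply/nbhs_ballP; exists e%:C; first by rewrite /= ltcR.
by move=> w; rewrite -ball_normE/= normc_normr ltcR => zw; exact: eU.
Qed.

Definition rational_square (q : rat * rat * rat) : set C :=
  [set w | `|ratr q.1.1 - Re w| < ratr q.2 /\ `|ratr q.1.2 - Im w| < ratr q.2].

Lemma open_rational_squares (U : set C) : open U ->
  U = \bigcup_(q in [set q | rational_square q `<=` U]) rational_square q.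
Proof.
move=> oU; apply/seteqP; split; last by apply: bigcup_sub => q; exact.
move=> z Uz; have /complex_nbhsP[e e0 eU] : nbhs z U by exact: open_nbhs_nbhs.
(* The centre is within [ratr r] of [z] in each coordinate and [w] within [ratr r] of the centre, so
   each coordinate moves by less than 2r and the modulus by less than 4r < e. *)
have e4 : 0 < e / 4 by rewrite divr_gt0.
have [r] := rat_in_itvoo e4; rewrite in_itv/= => /andP[r0 re].
have near_rat (x : R) : exists q : rat, `|ratr q - x| < ratr r.
  have /rat_in_itvoo[q] : x - ratr r < x + ratr r.
    by rewrite ltrBlDr -addrA ltrDl addr_gt0.
  by rewrite in_itv/= => xqx; exists q; rewrite ltr_distl.
have [a ax] := near_rat (Re z); have [b bx] := near_rat (Im z).
exists (a, b, r) => //= w [/= aw bw]; apply: eU => /=.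
rewrite (le_lt_trans (normc_le_ReIm _))// !raddfB/=.
move: ax bx aw bw; rewrite !ltr_norml => /andP[? ?] /andP[? ?] /andP[? ?] /andP[? ?].
rewrite (@lt_trans _ _ (ratr r *+ 4))//; last by rewrite -mulr_natr; lra.
rewrite (@lt_le_trans _ _ (ratr r *+ 2 + ratr r *+ 2))//; last first.
  by rewrite -mulrnDr.
by rewrite ltrD// ltr_norml -mulr_natr; apply/andP; split; lra.
Qed.

End complex_topology.

Section complex_measurability.
Context d (T : measurableType d) (R : realType).
Local Notation C := (R[i]^o).
Implicit Types f g : T -> C.
Local Notation cmeasurable f := (measurable_fun [set: T] (f : T -> borel C)).

(** [Re] and [Im] are 1-Lipschitz, so they pull rays back to open sets. Conversely an open set is a
    union of rational squares, of which there are countably many, and the preimage of each is cut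
    out by [Re] and [Im]. *)
Lemma cmeasurableP f : cmeasurable f <->
  measurable_fun setT (fun t => Re (f t)) /\ measurable_fun setT (fun t => Im (f t)).
Proof.
have ReImE (h : C -> R) : (forall z w, `|h z - h w| <= normc (z - w)) ->
    measurable_fun setT (f : T -> borel C) -> measurable_fun setT (h \o f).
  move=> h1 mf; apply: (measurability _ (RGenOInfty.measurableE R)) => _ [_ [a ->] <-].
  rewrite setTI comp_preimage -[X in measurable X]setTI; apply: mf => //.
  apply: sub_sigma_algebra => /=; rewrite /= openE => z /=.
  rewrite in_itv/= andbT => az; apply/complex_nbhsP; exists (h z - a).
    by rewrite subr_gt0.
  move=> w /= zw; rewrite in_itv/= andbT.
  have := le_lt_trans (h1 z w) zw; rewrite ltr_norml => /andP[_].
  by rewrite ltrD2l ltrN2.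
split=> [mf|[mRe mIm]].
  by split; apply: ReImE => // z w; rewrite -raddfB; [exact: normc_Re|exact: normc_Im].
apply: (@measurability _ _ T (borel C) _ _ (@open C)) => // _ [U oU <-].
rewrite setTI (open_rational_squares oU) preimage_bigcup.
rewrite bigcup_mkcond; apply: countable_bigcupT_measurable => // q.
case: ifPn => // _.
rewrite (_ : _ @^-1` _ =
    ((fun t => `|ratr q.1.1 - Re (f t)|) @^-1` `]-oo, (ratr q.2)[) `&`
    ((fun t => `|ratr q.1.2 - Im (f t)|) @^-1` `]-oo, (ratr q.2)[)); last first.
  by apply/seteqP; split=> t; rewrite /= !in_itv.
have m (h : T -> R) (x y : R) : measurable_fun setT h ->
    measurable ((fun t => `|x - h t|) @^-1` `]-oo, y[).
  move=> mh; rewrite -[X in measurable X]setTI.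
  by apply: (measurableT_comp (@normr_measurable _ setT) (measurable_funB (measurable_cst _) mh)).
by apply: measurableI; exact: m.
Qed.

Lemma cmeasurable_normc f : cmeasurable f ->
  measurable_fun setT (fun t => normc (f t)).
Proof.
move=> /cmeasurableP[mRe mIm].
rewrite (_ : (fun _ => _) =
  Num.sqrt \o (fun t => (Re (f t)) ^+ 2 + (Im (f t)) ^+ 2)); last first.
  by apply/funext => t /=; case: (f t).
apply: measurableT_comp.
  by apply: continuous_measurable_fun; exact: sqrt_continuous.
by apply: measurable_funD; exact: measurable_funX.
Qed.

Lemma cmeasurableD f g : cmeasurable f -> cmeasurable g ->
  cmeasurable (fun t => f t + g t).
Proof.
move=> /cmeasurableP[fR fI] /cmeasurableP[gR gI]; apply/cmeasurableP.
by split; [have := measurable_funD fR gR|have := measurable_funD fI gI];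
  apply: eq_measurable_fun => t _ /=; case: (f t) => ? ?; case: (g t).
Qed.

Lemma cmeasurableZ a f : cmeasurable f -> cmeasurable (fun t => a * f t).
Proof.
case: a => a b /cmeasurableP[fR fI]; apply/cmeasurableP; split.
  have := measurable_funB (measurable_funM (measurable_cst a) fR)
    (measurable_funM (measurable_cst b) fI).
  by apply: eq_measurable_fun => t _ /=; case: (f t).
have := measurable_funD (measurable_funM (measurable_cst a) fI)
  (measurable_funM (measurable_cst b) fR).
by apply: eq_measurable_fun => t _ /=; case: (f t).
Qed.

Lemma cmeasurableB f g : cmeasurable f -> cmeasurable g ->
  cmeasurable (fun t => f t - g t).
Proof.
move=> mf /(@cmeasurableZ (-1)) mg.
by have := cmeasurableD mf mg; apply: eq_measurable_fun => t _; rewrite mulN1r.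
Qed.

End complex_measurability.

Lemma continuous_cmeasurable (R : realType) (G : topologicalZmodType)
    (f : G -> R[i]^o) :
  continuous f -> measurable_fun [set: borel G] (f : borel G -> borel (R[i]^o)).
Proof.
move=> cf; apply: (@measurability _ _ (borel G) (borel (R[i]^o)) _ _ (@open R[i]^o)) => //.
move=> _ [U oU <-]; rewrite setTI; apply: sub_sigma_algebra => /=.
by move/continuousP: cf; exact.
Qed.

(** * Borel sets and Haar measure *)

Section borel_sets.
Variable G : topologicalZmodType.
Implicit Types (U K X : set G) (t : G).
Local Notation bmeasurable X := (measurable (X : set (borel G))).

Lemma open_bmeasurable U : open U -> bmeasurable U.
Proof. exact: sub_sigma_algebra. Qed.

Lemma closed_bmeasurable K : closed K -> bmeasurable K.
Proof.
move=> cK; rewrite -[X in measurable X](@setCK G).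
by apply: measurableC; apply: open_bmeasurable; exact: closed_openC.
Qed.

Lemma compact_bmeasurable K : hausdorff_space G -> compact K -> bmeasurable K.
Proof. by move=> hG /(compact_closed hG); exact: closed_bmeasurable. Qed.

Lemma translateE t X : translate t X = [set x | X (x - t)].
Proof.
apply/seteqP; split=> [_ [x Xx <-]|x Xx] /=; first by rewrite addrC addKr.
by exists (x - t) => //; rewrite addrC subrK.
Qed.

Lemma translate0 X : translate 0 X = X.
Proof. by rewrite translateE; apply/seteqP; split=> x /=; rewrite subr0. Qed.

Lemma translateD s t X : translate s (translate t X) = translate (s + t) X.
Proof.
rewrite !translateE; apply/seteqP.
by split=> x /=; rewrite -addrA -opprD.
Qed.

Lemma translateI t X U : translate t (X `&` U) = translate t X `&` translate t U.
Proof. by rewrite !translateE. Qed.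

Lemma translate_setD t X U :
  translate t (X `\` U) = translate t X `\` translate t U.
Proof. by rewrite !translateE. Qed.

Lemma subr_const_continuous t : continuous (fun x : G => x - t).
Proof.
move=> x.
exact: (cvg_comp2 (h := fun a b : G => a + b) cvg_id (cvg_cst (- t))
  (@add_continuous G (x, - t))).
Qed.

Lemma open_translate t U : open U -> open (translate t U).
Proof.
by rewrite translateE; move/continuousP: (@subr_const_continuous t); exact.
Qed.

Lemma bmeasurable_translate t X : bmeasurable X -> bmeasurable (translate t X).
Proof.
move=> mX; rewrite translateE -[X in measurable X](@setTI G).
have : measurable_fun [set: borel G] (fun x : borel G => (x - t : G) : borel G).
  apply: (@measurability _ _ (borel G) (borel G) _ _ (@open G)) => // _ [U oU <-].
  rewrite setTI; apply: open_bmeasurable.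
  by move/continuousP: (@subr_const_continuous t); exact.
by move=> /(_ measurableT _ mX).
Qed.

(** Tube lemma for addition, which is continuous at each (0, b). *)
Lemma compact_tube (B U : set G) : compact B -> open U -> B `<=` U ->
  \forall w \near (0 : G), translate w B `<=` U.
Proof.
move=> cB oU BU.
have : \forall w \near (0 : G), B `<=` (fun b => U (w + b)).
  apply: (compact_near_coveringP B).1 => // b Bb.
  have : (fun z : G * G => z.2 + z.1) @ (b, (0 : G)) --> 0 + b.
    exact: (cvg_comp2 (h := fun a b : G => a + b) cvg_snd cvg_fst
      (@add_continuous G (0, b))).
  apply; rewrite add0r; apply: open_nbhs_nbhs; split=> //; exact: BU.
by apply: filterS => w wB _ [b Bb <-]; exact: wB.
Qed.

End borel_sets.

Section haar_regularity.
Variables (R : realType) (G : topologicalZmodType).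
Hypothesis hausdorffG : hausdorff_space G.
Variable mu : {measure set (borel G) -> \bar R}.
Hypothesis haar_mu : haar_measure mu.
Implicit Types (A U K X : set G).
Local Notation bmeasurable X := (measurable (X : set (borel G))).

Lemma haar_translate t X : bmeasurable X -> mu (translate t X) = mu X.
Proof. by case: haar_mu => _ + _ _ _; exact. Qed.

Lemma haar_compact K : compact K -> (mu K < +oo)%E.
Proof. by case: haar_mu => _ _ + _ _; exact. Qed.

Lemma haar_precompact A : bmeasurable A -> precompact A -> (mu A < +oo)%E.
Proof.
move=> mA [K AK [cK _]]; apply: le_lt_trans (haar_compact cK).
by apply: le_measure => //; rewrite inE//; exact: compact_bmeasurable.
Qed.

Lemma haar_finite X : (mu X < +oo)%E -> exists2 x, 0 <= x & mu X = x%:E.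
Proof.
move=> Xoo; exists (fine (mu X)); first exact: fine_ge0.
by rewrite fineK// ge0_fin_numE.
Qed.

Lemma measure_setDI X Y : bmeasurable X -> bmeasurable Y ->
  mu X = (mu (X `\` Y) + mu (X `&` Y))%E.
Proof. exact: measureDI. Qed.

Lemma haar_outer X e : bmeasurable X -> (mu X < +oo)%E -> 0 < e ->
  exists2 U, open U /\ X `<=` U & (mu U < mu X + e%:E)%E.
Proof.
move=> mX Xoo e0; case: haar_mu => _ _ _ /(_ _ mX) muX _.
have /ereal_inf_lt[_ [U [oU XU] <-] Ue] :
    (ereal_inf [set mu U | U in [set U | open U /\ X `<=` U]] < mu X + e%:E)%E.
  by rewrite -muX lteDl ?lte_fin// ge0_fin_numE.
by exists U.
Qed.

(** Haar measure comes with inner regularity on open sets only. For a pre-compact [A] inside a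
    closed compact [K], outer regularity of [K \ A] gives an open [U], and [K \ U] is the compact
    set: what it misses of [A] lies in [U \ (K \ A)]. *)
Lemma haar_inner A e : bmeasurable A -> precompact A -> 0 < e ->
  exists2 B, compact B /\ B `<=` A & (mu (A `\` B) < e%:E)%E.
Proof.
move=> mA [K AK [cK clK]] e0.
have mK := compact_bmeasurable hausdorffG cK.
have mKA : bmeasurable (K `\` A) by exact: measurableD.
have KAoo : (mu (K `\` A) < +oo)%E.
  apply: le_lt_trans (haar_compact cK).
  by apply: le_measure; rewrite ?inE//; exact: subDsetl.
have [U [oU KAU] Ue] := haar_outer mKA KAoo e0.
have mU := open_bmeasurable oU.
exists (K `\` U).
  split; last by move=> x [Kx nUx]; apply: contrapT => nAx; apply: nUx; exact: KAU.
  apply: (subclosed_compact _ cK); last exact: subDsetl.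
  by apply: closedI => //; exact: open_closedC.
apply: (@le_lt_trans _ _ (mu (U `\` (K `\` A)))).
  apply: le_measure; rewrite ?inE; [|exact: measurableD|].
    by apply: measurableD => //; exact: measurableD.
  move=> x [Ax nKU]; split; last by case.
  by apply: contrapT => nUx; apply: nKU; split=> //; exact: AK.
have := measure_setDI mU mKA; rewrite (setIidr KAU) => UE.
by move: Ue; rewrite UE addeC lteD2lE// ge0_fin_numE.
Qed.

(** With B compact, U open, B ⊆ A ⊆ U and w + B ⊆ U for w near 0, the set A \ (w + A) lies in U \ (w
    + B), of measure |U| - |B| < e. *)
Lemma haar_translate_near0 A e : bmeasurable A -> precompact A -> 0 < e ->
  \forall w \near (0 : G), (mu (A `\` translate w A) < e%:E)%E.
Proof.
move=> mA pA e0; have e2 : 0 < e / 2 by rewrite divr_gt0.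
have Aoo := haar_precompact mA pA.
have [B [cB BA] Be] := haar_inner mA pA e2.
have [U [oU AU] Ue] := haar_outer mA Aoo e2.
have mB := compact_bmeasurable hausdorffG cB.
have mU := open_bmeasurable oU.
apply: filterS (compact_tube cB oU (subset_trans BA AU)) => w wBU.
have mwB := bmeasurable_translate w mB.
apply: (@le_lt_trans _ _ (mu (U `\` translate w B))).
  apply: le_measure; rewrite ?inE; [|exact: measurableD|].
    by apply: measurableD => //; exact: bmeasurable_translate.
  move=> x [Ax nwA]; split; first exact: AU.
  by move=> [b Bb bx]; apply: nwA; exists b => //; exact: BA.
have := measure_setDI mU mwB; rewrite (setIidr wBU) haar_translate// => UE.
have := measure_setDI mA mB; rewrite (setIidr BA) => AE.
have : (mu B < +oo)%E by exact: haar_compact.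
have UBoo : (mu (U `\` translate w B) < +oo)%E.
  apply: (@le_lt_trans _ _ (mu U)); last by rewrite (lt_trans Ue)// lte_add_pinfty// ltry.
  by apply: le_measure; rewrite ?inE//; exact: measurableD.
move: AE UE Ue; have [x _ ->] := haar_finite UBoo.
move: Be => /[dup] /lt_trans/(_ (ltry _))/haar_finite[y _ ->] ye.
move=> -> -> + /haar_finite[b _ bE]; rewrite bE -!EFinD !lte_fin in ye *.
by lra.
Qed.

(** A \ (x + A) is covered by A \ (t + A) and the translate by t of A \ ((x - t) + A), and the
    latter is small for x near t. Openness serves to make sets of almost-invariant translations
    measurable. *)
Lemma open_almost_invariant A c : bmeasurable A -> precompact A ->
  open [set t | (mu (A `\` translate t A) < c%:E)%E].
Proof.
move=> mA pA; set S := (X in open X); rewrite openE => t; rewrite {}/S/= => tc.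
have mwA w := bmeasurable_translate w mA.
have [r r0 rE] : exists2 r, 0 <= r & mu (A `\` translate t A) = r%:E.
  by apply: haar_finite; rewrite (lt_trans tc)// ltry.
have d0 : 0 < c - r by rewrite subr_gt0 -lte_fin -rE.
have wt : (fun x : G => x - t) @ t --> (0 : G).
  by rewrite -(subrr t); exact: subr_const_continuous.
have : \forall x \near t, (mu (A `\` translate (x - t) A) < (c - r)%:E)%E.
  exact: wt _ (haar_translate_near0 mA pA d0).
rewrite /interior; apply: filterS => x xt /=.
apply: (@le_lt_trans _ _ (mu (A `\` translate t A) +
    mu (translate t (A `\` translate (x - t) A)))%E).
  apply: le_trans (measureU2 _ _ _) => //; last first.
  - by apply: bmeasurable_translate; exact: measurableD.
  - exact: measurableD.
  apply: le_measure; rewrite ?inE; [exact: measurableD| |].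
    apply: measurableU; first exact: measurableD.
    by apply: bmeasurable_translate; exact: measurableD.
  rewrite translate_setD translateD addrC subrK => z [Az nxA].
  by have [tz|tz] := pselect (translate t A z); [right|left].
rewrite haar_translate; last exact: measurableD.
have [s _ sE] : exists2 s, 0 <= s & mu (A `\` translate (x - t) A) = s%:E.
  by apply: haar_finite; rewrite (lt_trans xt)// ltry.
by move: xt; rewrite rE sE -EFinD !lte_fin ltrBrDl.
Qed.

End haar_regularity.

(** * Volume of Folner sets *)

Section folner_measure.
Variables (R : realType) (G : topologicalZmodType).
Hypothesis hausdorffG : hausdorff_space G.
Variable mu : {measure set (borel G) -> \bar R}.
Hypothesis haar_mu : haar_measure mu.
Implicit Types (A U K X T V W : set G).
Local Notation bmeasurable X := (measurable (X : set (borel G))).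

(* A substitute for Fubini, which is not available when the Borel sigma-algebra
   of G * G is larger than the product: T is cut into pieces T_i around points
   t_i so small that s + t_i in B implies s + T_i in U, and g is the finite sum
   of the |T_i| times the indicator of B - t_i. *)
Lemma overlap_weight (A B U V W T : set G) (q : \bar R) (xs : seq G) :
  bmeasurable A -> bmeasurable B -> bmeasurable U -> bmeasurable W ->
  (forall b v, B b -> V v -> U (b + v)) ->
  (forall v w, W v -> W w -> V (v - w)) ->
  (0 <= q)%E ->
  bmeasurable T ->
  (forall t, T t -> (q <= mu (A `&` translate (- t) B))%E) ->
  (forall t, T t -> exists2 x, x \in xs & translate x W t) ->
  exists g : borel G -> \bar R, [/\ measurable_fun [set: borel G] g,
    forall s, (0 <= g s)%E,
    forall s, (g s <= mu (translate s T `&` U))%E &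
    (q * mu T <= \int[mu]_(s in (A : set (borel G))) g s)%E].
Proof.
move=> mA mB mU mW BVU WV q0.
elim: xs T => [|x xs IH] T mT Tq Txs.
  have -> : T = set0 by apply/seteqP; split=> // t /Txs[].
  exists (cst 0%E); split=> [||s|]; [exact: measurable_cst|by []|exact: measure_ge0|].
  by rewrite measure0 mule0 integral0.
set T1 := T `&` translate x W; set T2 := T `\` translate x W.
have mxW := bmeasurable_translate x mW.
have mT1 : bmeasurable T1 by exact: measurableI.
have mT2 : bmeasurable T2 by exact: measurableD.
have [g [mg g0 gU gq]] : exists g : borel G -> \bar R,
    [/\ measurable_fun [set: borel G] g,
    forall s, (0 <= g s)%E,
    forall s, (g s <= mu (translate s T2 `&` U))%E &
    (q * mu T2 <= \int[mu]_(s in (A : set (borel G))) g s)%E].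
  apply: IH => // [t [Tt _]|t [Tt xWt]]; first exact: Tq.
  have [y] := Txs _ Tt; rewrite inE => /predU1P[->//|yxs yt].
  by exists y.
have [/set0P[t [Tt xWt]]|] := boolP (T1 != set0); last first.
  rewrite negbK => /eqP T10; have T2E : T2 = T.
    by rewrite /T2; apply/setDidl.
  by rewrite -T2E; exists g.
have mtB := bmeasurable_translate (- t) mB.
pose h (s : borel G) : \bar R := (mu T1 * (\1_(translate (- t) B) s)%:E)%E.
have mh : measurable_fun [set: borel G] h.
  apply: measurable_funeM; apply/measurable_EFinP.
  exact: measurable_indic.
have h0 s : (0 <= h s)%E by rewrite mule_ge0// lee_fin.
exists (g \+ h)%E; split.
- exact: emeasurable_funD.
- by move=> s; rewrite adde_ge0.
- move=> s.
  have mst X : bmeasurable X -> bmeasurable (translate s X) by exact: bmeasurable_translate.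
  have [tBs|ntBs] := pselect (translate (- t) B s); last first.
    rewrite /h /= indicE memNset// mule0 adde0 (le_trans (gU s))//.
    apply: le_measure; rewrite ?inE; [by apply: measurableI; auto..|].
    by apply: setSI => _ [y [Ty _] <-]; exists y.
  rewrite /h /= indicE mem_set// mule1.
  (* For t = x + v and y = x + w in the same translate of [W], s = b - t gives s + y = b + (w - v),
     a point of B + V. *)
  have sT1U : translate s T1 `<=` U.
    move=> _ [y [Ty [w Ww wy]] <-]; case: xWt => v Wv vt.
    case: tBs => b Bb <-.
    suff -> : - t + b + y = b + (w - v) by apply: BVU => //; exact: WV.
    by rewrite -wy -vt opprD addrAC [LHS]addrC addrACA addNr add0r [- v + w]addrC.
  rewrite -(haar_translate haar_mu s mT1) (le_trans (leeD2r _ (gU s)))//.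
  rewrite -[X in (_ + mu X <= _)%E](setIidl sT1U) -measureU.
  + apply: le_measure; rewrite ?inE; [|by apply: measurableI; auto|].
      by apply: measurableU; apply: measurableI; auto.
    by rewrite -setIUl; apply: setSI => z [] [y [Ty _] <-]; exists y.
  + by apply: measurableI; auto.
  + by apply: measurableI; auto.
  + apply/seteqP; split=> // z [[[y [_ ny] yz] _] [[w [_ xw] wz] _]]; apply: ny.
    by rewrite -(@addrI G s _ _ (etrans wz (esym yz))).
- rewrite ge0_integralD//; [|exact: measurable_funTS..].
  rewrite /h ge0_integralZl//; last first.
    by apply/measurable_EFinP; exact: measurable_funTS.
  rewrite integral_indic// setIC (_ : mu T = mu T2 + mu T1)%E; last exact: measure_setDI.
  rewrite ge0_muleDr// leeD//.
  by rewrite muleC lee_wpmul2l// Tq.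
Qed.

(** Double counting: q |T| is at most the integral over t in T of |A ∩ (B - t)|, which formally
    equals the integral over s in A of |(s + T) ∩ B|. The weight [g] stands between q |T| and the
    second integral with B enlarged to U, whose integrand is at most |U|. *)
Lemma overlap_mul_le (A B U V T K : set G) (q : \bar R) :
  bmeasurable A -> bmeasurable B -> bmeasurable U ->
  nbhs (0 : G) V -> (forall b v, B b -> V v -> U (b + v)) ->
  (0 <= q)%E ->
  bmeasurable T -> compact K -> T `<=` K ->
  (forall t, T t -> (q <= mu (A `&` translate (- t) B))%E) ->
  (q * mu T <= mu A * mu U)%E.
Proof.
move=> mA mB mU V0 BVU q0 mT cK TK Tq.
have : (fun z : G * G => z.1 - z.2) @ ((0 : G), (0 : G)) --> (0 : G).
  have snd0 : (fun z : G * G => - z.2) @ ((0 : G), (0 : G)) --> - (0 : G).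
    exact: (@cvg_comp _ _ _ snd (fun x : G => - x) _ _ _ cvg_snd
      (@opp_continuous G 0)).
  rewrite -[X in _ --> X](subrr (0 : G)).
  exact: (cvg_comp2 (h := fun a b : G => a + b) cvg_fst snd0
    (@add_continuous G (0, - 0))).
move=> /(_ _ V0)[[P1 P2] /= [P10 P20] PV].
(* W - W lies in V, and the interior makes the translates of W an open cover of the compact K, so
   finitely many of them suffice. *)
pose W : set G := (P1 `&` P2)^°.
have W0 : nbhs (0 : G) W.
  by apply: open_nbhs_nbhs; split; [exact: open_interior|exact: filterI].
have oW : open W by exact: open_interior.
have WV v w : W v -> W w -> V (v - w).
  move=> /interior_subset[P1v _] /interior_subset[_ P2w].
  exact: (PV (v, w)).
have : cover_compact (K : set (pointed0 G)) by rewrite -compact_cover.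
move=> /(_ (pointed0 G) setT (fun x => translate x W))[].
- by move=> x _; exact: open_translate.
- move=> x _; exists x => //; exists 0; last exact: addr0.
  exact: nbhs_singleton.
move=> D _ KD.
have [t Tt|g [mg g0 gU /le_trans]] := @overlap_weight A B U V W T q (enum_fset D)
    mA mB mU (open_bmeasurable oW) BVU WV q0 mT Tq.
  by have [x xD tx] := KD _ (TK _ Tt); exists x.
apply.
rewrite muleC -integral_cst//; apply: ge0_le_integral => //.
- exact: measurable_funTS.
- move=> s _; apply: le_trans (gU s) _.
  apply: le_measure; rewrite ?inE//; apply: measurableI => //.
  exact: bmeasurable_translate.
Qed.

(* By regularity, t |-> mu (A n `\` (t + A n)) is continuous enough for the sets
   T N of points of K where the Folner ratio is small for all n >= N to be
   measurable; their measures tend to |K|. *)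
Lemma folner_measure_ge (A : (set G)^nat) (K : set G) (c : R) :
  folner mu A -> compact K -> (c%:E < mu K)%E ->
  \forall n \near \oo, (c%:E <= mu (A n))%E.
Proof.
move=> [mA pA A0 Afol] cK cmuK.
have [c0|c0] := ltP c 0.
  by near=> n; rewrite (@le_trans _ _ 0%E)// lee_fin ltW.
have [k k0 kE] := haar_finite (haar_compact haar_mu cK).
have mK := compact_bmeasurable hausdorffG cK.
rewrite kE lte_fin in cmuK.
pose c' := (c + k) / 2.
have cc' : c < c' by rewrite /c'; lra.
have c'k : c' < k by rewrite /c'; lra.
have d0 : 0 < 2 * c' + c + 1 by lra.
(* Chosen so that (1 - 2e) c' = (1 + e) c + e, which beats the losses below: 2e from the overlaps
   and e from |U| < (1 + e) |A_n|. *)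
pose e := (c' - c) / (2 * c' + c + 1).
have e0 : 0 < e by rewrite divr_gt0// subr_gt0.
have eE : e * (2 * c' + c + 1) = c' - c by rewrite mulfVK// gt_eqF.
have e12 : 0 <= 1 - 2 * e by rewrite subr_ge0 -ler_pdivlMl// mulrC ler_pdivrMr//; lra.
have Aoo n : (mu (A n) < +oo)%E by exact: haar_precompact.
pose a n := fine (mu (A n)).
have aE n : mu (A n) = (a n)%:E by rewrite fineK// ge0_fin_numE.
have a0 n : 0 < a n by rewrite -lte_fin -aE.
pose P n := [set t | (mu (A n `\` translate t (A n)) < (e * a n)%:E)%E].
pose T N := K `&` \bigcap_(n in [set n | (N <= n)%N]) P n.
have mP n : bmeasurable (P n).
  by apply: open_bmeasurable; exact: open_almost_invariant.
have mT N : bmeasurable (T N) by apply: measurableI => //; exact: bigcap_measurableType.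
have UT : \bigcup_N T N = K.
  apply/seteqP; split=> [t [N _ []]//|t Kt].
  have : \forall n \near \oo, P n t.
    have : \forall n \near \oo,
        (mu (A n `+` translate t (A n)) / mu (A n) < e%:E)%E.
      apply: (Afol t [set y | (y < e%:E)%E]); apply: open_nbhs_nbhs.
      by split; [exact: open_ereal_lt_ereal|rewrite /= lte_fin].
    apply: filterS => n; rewrite aE inver gt_eqF// lte_pdivrMr// -EFinM /P /=.
    apply: le_lt_trans; have mtA := bmeasurable_translate t (mA n).
    apply: le_measure; rewrite ?inE; [exact: measurableD| |].
      by apply: measurableU; exact: measurableD.
    exact: subsetUl.
  by move=> [N _ NP]; exists N.
have : (mu \o T) @ \oo --> mu K.
  rewrite -UT; apply: nondecreasing_cvg_mu => //; first by rewrite UT.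
  move=> m n mn; apply/subsetPset => t [Kt Tt]; split=> // j nj.
  by apply: Tt; exact: leq_trans nj.
move=> TK.
have [N TN] : exists N, (c'%:E < mu (T N))%E.
  apply: (@filter_ex _ \oo); apply: (TK [set y | (c'%:E < y)%E]).
  apply: open_nbhs_nbhs; split; first exact: open_ereal_gt_ereal.
  by rewrite /= kE lte_fin.
exists N => // n /= Nn.
have ea0 : 0 < e * a n by rewrite mulr_gt0.
have [B [cB BA] Be] := haar_inner hausdorffG haar_mu (mA n) (pA n) ea0.
have [U [oU AU] Ue] := haar_outer haar_mu (mA n) (Aoo n) ea0.
have mB := compact_bmeasurable hausdorffG cB.
have mU := open_bmeasurable oU.
have V0 := compact_tube cB oU (subset_trans BA AU).
(* For t in [T N], |A_n ∩ (B - t)| = |B ∩ (t + A_n)|; at most e |A_n| is lost to [A n \ B] and at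
   most e |A_n| to the translation, whence the factor 1 - 2e. *)
have : (((1 - 2 * e) * a n)%:E * mu (T N) <= mu (A n) * mu U)%E.
  apply: (overlap_mul_le (mA n) mB mU V0 _ _ (mT N) cK).
  - by move=> b v Bb; apply; exists b => //; exact: addrC.
  - by rewrite lee_fin mulr_ge0// ltW.
  - by move=> t [].
  move=> t [_ /(_ _ Nn)]; rewrite /P/= => tA.
  have mtA := bmeasurable_translate t (mA n).
  have -> : mu (A n `&` translate (- t) B) = mu (B `&` translate t (A n)).
    rewrite -(haar_translate haar_mu t); last first.
      by apply: measurableI => //; exact: bmeasurable_translate.
    by rewrite translateI translateD subrr translate0 setIC.
  have BAt : (mu (B `\` translate t (A n)) < (e * a n)%:E)%E.
    apply: le_lt_trans tA; apply: le_measure; rewrite ?inE; [exact: measurableD..|].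
    exact: setSD.
  have := measure_setDI mu mB mtA.
  have := measure_setDI mu (mA n) mB; rewrite (setIidr BA) aE.
  move: Be BAt.
  move=> /[dup] /lt_trans/(_ (ltry _))/haar_finite[x _ ->] xe.
  move=> /[dup] /lt_trans/(_ (ltry _))/haar_finite[y _ ->] ye.
  have [b _ ->] := haar_finite (haar_compact haar_mu cB).
  have [z _ ->] : exists2 z, 0 <= z & mu (B `&` translate t (A n)) = z%:E.
    apply: haar_finite; apply: le_lt_trans (haar_compact haar_mu cB).
    by apply: le_measure; rewrite ?inE//; exact: measurableI.
  rewrite -!EFinD lee_fin => -[anE] -[bE].
  by move: xe ye; rewrite !lte_fin => xe ye; lra.
have [u _ uE] : exists2 u, 0 <= u & mu U = u%:E.
  by apply: haar_finite; rewrite (lt_trans Ue)// aE -EFinD ltry.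
have [t _ tE] : exists2 t, 0 <= t & mu (T N) = t%:E.
  apply: haar_finite; apply: le_lt_trans (haar_compact haar_mu cK).
  by apply: le_measure; rewrite ?inE//; move=> ? [].
move: Ue TN; rewrite uE tE aE -!EFinM -EFinD !lte_fin !lee_fin => ua ct.
rewrite [X in X <= _]mulrAC [X in _ <= X]mulrC ler_pM2r// => le1.
have le2 : (1 - 2 * e) * c' <= u by apply: le_trans le1; rewrite ler_wpM2l// ltW.
have : (1 + e) * c <= (1 + e) * a n by nra.
by rewrite ler_pM2l//; lra.
Unshelve. all: by end_near. Qed.
End folner_measure.

(** * Upper limits and normalized L^p norms *)

Section limsup_nonneg.
Variable R : realType.
Implicit Types u v : (\bar R)^nat.
Local Open Scope ereal_scope.

Lemma limn_esup_lt u (x : \bar R) : limn_esup u < x -> \forall n \near \oo, u n < x.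
Proof.
move=> /ereal_inf_lt[_ [V Voo <-] Vx].
apply: filterS Voo => n Vn; apply: le_lt_trans Vx.
by apply: ereal_sup_ubound; exists n.
Qed.

Lemma limn_esup_le_near u (x : \bar R) :
  (\forall n \near \oo, u n <= x) -> limn_esup u <= x.
Proof.
move=> ux; apply: (@le_trans _ _ (ereal_sup [set u n | n in [set n | u n <= x]])).
  by apply: ereal_inf_lbound; exists [set n | u n <= x].
by apply: ge_ereal_sup => _ [n /= un <-].
Qed.

Lemma limn_esup_ge0 u : (forall n, 0 <= u n) -> 0 <= limn_esup u.
Proof.
by move=> u0; apply: limf_esup_ge0.
Qed.

Lemma le_limn_esup u v : (\forall n \near \oo, u n <= v n) ->
  limn_esup u <= limn_esup v.
Proof.
move=> uv; apply: le_ereal_inf_tmp => _ [V Voo <-].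
apply: limn_esup_le_near; near=> n.
apply: (@le_trans _ _ (v n)); first by near: n.
by apply: ereal_sup_ubound; exists n => //; near: n.
Unshelve. all: by end_near. Qed.

Lemma limn_esupD_le u v : (forall n, 0 <= u n) -> (forall n, 0 <= v n) ->
  limn_esup (fun n => u n + v n) <= limn_esup u + limn_esup v.
Proof.
move=> u0 v0; have := limn_esup_ge0 u0; have := limn_esup_ge0 v0.
case vE : (limn_esup v) => [b| |]// _; last first.
  by case: (limn_esup u) => // [a|] _; rewrite leey.
case uE : (limn_esup u) => [a| |]// _; last by rewrite leey.
apply/lee_addgt0Pr => e e0; apply: limn_esup_le_near.
have e2 : (0 < e / 2)%R by rewrite divr_gt0.
have : \forall n \near \oo, u n < (a + e / 2)%:E.
  by apply: limn_esup_lt; rewrite uE lte_fin ltrDl.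
have : \forall n \near \oo, v n < (b + e / 2)%:E.
  by apply: limn_esup_lt; rewrite vE lte_fin ltrDl.
apply: filterS2 => n /ltW vn /ltW un; apply: le_trans (leeD un vn) _.
by rewrite -!EFinD lee_fin; lra.
Qed.

Lemma limn_esupZ_le u c : (0 < c)%R -> (forall n, 0 <= u n) ->
  limn_esup (fun n => c%:E * u n) <= c%:E * limn_esup u.
Proof.
move=> c0 u0; have := limn_esup_ge0 u0.
case uE : (limn_esup u) => [a| |]// _; last by rewrite gt0_muley ?lte_fin// leey.
apply/lee_addgt0Pr => e e0; apply: limn_esup_le_near.
have : \forall n \near \oo, u n < (a + c^-1 * e)%:E.
  by apply: limn_esup_lt; rewrite uE lte_fin ltrDl mulr_gt0// invr_gt0.
apply: filterS => n /ltW un.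
apply: le_trans (lee_wpmul2l _ un) _; first by rewrite lee_fin ltW.
by rewrite -!EFinM -EFinD lee_fin mulrDr mulVKf// gt_eqF.
Qed.

Lemma limn_esupZ u c : (0 <= c)%R -> (forall n, 0 <= u n) ->
  limn_esup (fun n => c%:E * u n) = c%:E * limn_esup u.
Proof.
(* The case c = 0 relies on 0 * oo = 0, as the upper limit may be infinite. For c > 0 the converse
   inequality is [limn_esupZ_le] for the factor [c^-1]. *)
rewrite le_eqVlt => /predU1P[<- u0|c0 u0].
  rewrite mul0e; apply/eqP; rewrite eq_le limn_esup_ge0 ?andbT; last first.
    by move=> n; rewrite mul0e.
  by apply: limn_esup_le_near; apply: nearW => n; rewrite mul0e.
apply/eqP; rewrite eq_le limn_esupZ_le//=.
rewrite muleC -lee_pdivlMr// muleC.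
rewrite [leLHS](_ : _ = limn_esup (fun n => c^-1%:E * (c%:E * u n))).
  apply: limn_esupZ_le; first by rewrite invr_gt0.
  by move=> n; rewrite mule_ge0// lee_fin ltW.
congr limn_esup; apply/funext => n.
by rewrite muleA -EFinM mulVf ?mul1e// gt_eqF.
Qed.

End limsup_nonneg.

Section mean_norm.
Context d (T : measurableType d) (R : realType).
Variables (mu : {measure set T -> \bar R}) (p : R).
Hypothesis p1 : 1 <= p.
Implicit Types (D : set T) (f g h : T -> R).

(** The term under the upper limit in [bes_norm], isolated on an arbitrary measure space and for
    real functions, to be applied to moduli. *)
Definition mean_norm D f : \bar R :=
  ((mu D)^-1 * \int[mu]_(t in D) (f t `^ p)%:E) `^ p^-1.

Let p0 : 0 < p. Proof. exact: lt_le_trans p1. Qed.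
Let pN0 : p != 0. Proof. by rewrite gt_eqF. Qed.

Lemma integral_powR_ge0 D f : (0 <= \int[mu]_(t in D) (f t `^ p)%:E)%E.
Proof. by apply: integral_ge0 => t _; rewrite lee_fin powR_ge0. Qed.

Lemma measurable_powR_comp D f : measurable_fun [set: T] f ->
  measurable_fun D (fun t => (f t `^ p)%:E).
Proof.
move=> mf; apply: measurable_funTS; apply/measurable_EFinP.
exact: (measurableT_comp (measurable_powR p)).
Qed.

Lemma le_integral_powR D f g : measurable D ->
  measurable_fun [set: T] f -> measurable_fun [set: T] g ->
  (forall t, D t -> 0 <= f t <= g t) ->
  (\int[mu]_(t in D) (f t `^ p)%:E <= \int[mu]_(t in D) (g t `^ p)%:E)%E.
Proof.
move=> mD mf mg fg; apply: ge0_le_integral => //.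
- by move=> t _; rewrite lee_fin powR_ge0.
- exact: measurable_powR_comp.
- exact: measurable_powR_comp.
- move=> t /fg/andP[f0 fgt]; rewrite lee_fin ge0_ler_powR ?nnegrE// ?(ltW p0)//.
  exact: le_trans fgt.
Qed.

Lemma integral_powRZ D f c : measurable D -> measurable_fun [set: T] f ->
  (forall t, 0 <= f t) -> 0 <= c ->
  (\int[mu]_(t in D) ((c * f t) `^ p)%:E =
   (c `^ p)%:E * \int[mu]_(t in D) (f t `^ p)%:E)%E.
Proof.
move=> mD mf f0 c0; rewrite -ge0_integralZl_EFin ?powR_ge0//.
- by apply: eq_integral => t _; rewrite powRM.
- by move=> t _; rewrite lee_fin powR_ge0.
- exact: measurable_powR_comp.
Qed.

(** Pointwise f + g <= 2 max(f, g), so (f + g)^p <= (2f)^p + (2g)^p. *)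
Lemma integral_powRD_lty D f g : measurable D ->
  measurable_fun [set: T] f -> measurable_fun [set: T] g ->
  (forall t, 0 <= f t) -> (forall t, 0 <= g t) ->
  (\int[mu]_(t in D) (f t `^ p)%:E < +oo)%E ->
  (\int[mu]_(t in D) (g t `^ p)%:E < +oo)%E ->
  (\int[mu]_(t in D) ((f t + g t) `^ p)%:E < +oo)%E.
Proof.
move=> mD mf mg f0 g0 foo goo.
have m2 h : measurable_fun [set: T] h -> measurable_fun [set: T] (fun t => 2 * h t).
  by move=> mh; exact: measurable_funM.
apply: (@le_lt_trans _ _ (\int[mu]_(t in D) (((2 * f t) `^ p)%:E + ((2 * g t) `^ p)%:E))%E).
  apply: ge0_le_integral => //.
  - by move=> t _; rewrite lee_fin powR_ge0.
  - by apply: measurable_powR_comp; exact: measurable_funD.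
  - by apply: emeasurable_funD; apply: measurable_powR_comp; exact: m2.
  - move=> t _; rewrite -EFinD lee_fin.
    have [fg|/ltW gf] := leP (f t) (g t).
      rewrite (@le_trans _ _ ((2 * g t) `^ p))// ?lerDr ?powR_ge0//.
      rewrite ge0_ler_powR ?nnegrE ?addr_ge0 ?mulr_ge0 ?(ltW p0)//.
      by rewrite mulr2n mulrDl mul1r lerD2r.
    rewrite (@le_trans _ _ ((2 * f t) `^ p))// ?lerDl ?powR_ge0//.
    rewrite ge0_ler_powR ?nnegrE ?addr_ge0 ?mulr_ge0 ?(ltW p0)//.
    by rewrite mulr2n mulrDl mul1r lerD2l.
have pos h t : D t -> (0 <= (h t `^ p)%:E)%E by rewrite lee_fin powR_ge0.
rewrite ge0_integralD//; [|exact: pos|by apply: measurable_powR_comp; exact: m2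
                          |exact: pos|by apply: measurable_powR_comp; exact: m2].
by rewrite !integral_powRZ// lte_add_pinfty// lte_mul_pinfty// lee_fin powR_ge0.
Qed.

(** Minkowski's inequality on the whole space, applied to the functions extended by 0 outside [D];
    the extension adds nothing to the integrals because 0^p = 0. *)
Lemma integral_powRD_le D f g : measurable D ->
  measurable_fun [set: T] f -> measurable_fun [set: T] g ->
  (forall t, 0 <= f t) -> (forall t, 0 <= g t) ->
  ((\int[mu]_(t in D) ((f t + g t) `^ p)%:E) `^ p^-1 <=
   (\int[mu]_(t in D) (f t `^ p)%:E) `^ p^-1 +
   (\int[mu]_(t in D) (g t `^ p)%:E) `^ p^-1)%E.
Proof.
move=> mD mf mg f0 g0.
have E h : (forall t, 0 <= h t) -> ((\int[mu]_(t in D) (h t `^ p)%:E) `^ p^-1)%E =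
    Lnorm mu p%:E (EFin \o (h \_ D)).
  move=> h0; rewrite unlock; congr (_ `^ _)%E; rewrite integral_mkcond.
  apply: eq_integral => t _ /=; rewrite /patch; case: ifPn => tD.
    by rewrite ger0_norm.
  by rewrite normr0 powR0.
rewrite !E//; last by move=> t; rewrite addr_ge0.
rewrite (_ : (fun t => f t + g t) \_ D = (f \_ D \+ g \_ D)%R); last first.
  by apply/funext => t; rewrite /patch/=; case: ifPn => //; rewrite addr0.
by apply: minkowski_EFin => //; apply/(measurable_restrictT _ mD); exact: measurable_funTS.
Qed.

Section finite_domain.
Variables (D : set T) (a : R).
Hypotheses (mD : measurable D) (muD : mu D = a%:E) (a0 : 0 < a).

Let w : R := a^-1 `^ p^-1.
Let w0 : 0 < w. Proof. by rewrite powR_gt0// invr_gt0. Qed.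

Lemma mean_normE f : mean_norm D f =
  (w%:E * (\int[mu]_(t in D) (f t `^ p)%:E) `^ p^-1)%E.
Proof.
rewrite /mean_norm muD inver gt_eqF// poweRM ?integral_powR_ge0//.
by rewrite lee_fin ltW// invr_gt0.
Qed.

Lemma mean_normD f g :
  measurable_fun [set: T] f -> measurable_fun [set: T] g ->
  (forall t, 0 <= f t) -> (forall t, 0 <= g t) ->
  (mean_norm D (fun t => f t + g t)%R <= mean_norm D f + mean_norm D g)%E.
Proof.
move=> mf mg f0 g0; rewrite !mean_normE -ge0_muleDr ?poweR_ge0//.
by apply: lee_wpmul2l; [rewrite lee_fin ltW|exact: integral_powRD_le].
Qed.

Lemma le_mean_norm f g :
  measurable_fun [set: T] f -> measurable_fun [set: T] g ->
  (forall t, D t -> 0 <= f t <= g t) -> (mean_norm D f <= mean_norm D g)%E.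
Proof.
move=> mf mg fg; rewrite !mean_normE lee_wpmul2l ?lee_fin ?(ltW w0)//.
apply: gt0_ler_poweR; rewrite ?invr_ge0 ?(ltW p0)//.
- by rewrite in_itv/= integral_powR_ge0 leey.
- by rewrite in_itv/= integral_powR_ge0 leey.
- exact: le_integral_powR.
Qed.

Lemma mean_normZ f c : measurable_fun [set: T] f -> (forall t, 0 <= f t) ->
  0 <= c -> mean_norm D (fun t => c * f t)%R = (c%:E * mean_norm D f)%E.
Proof.
move=> mf f0 c0; rewrite !mean_normE integral_powRZ//.
rewrite poweRM ?lee_fin ?powR_ge0 ?integral_powR_ge0//.
by rewrite poweR_EFin -powRrM mulfV// powRr1// muleCA.
Qed.

Lemma mean_norm_leP f x : 0 <= x ->
  (mean_norm D f <= x%:E)%E = (\int[mu]_(t in D) (f t `^ p)%:E <= (x `^ p * a)%:E)%E.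
Proof.
move=> x0; rewrite /mean_norm muD inver gt_eqF//.
rewrite EFinM -lee_pdivrMr// muleC.
set I := (_ * _)%E; have I0 : (0 <= I)%E.
  by rewrite mule_ge0 ?integral_powR_ge0// lee_fin invr_ge0 ltW.
have xE : (x `^ p)%:E = (x%:E `^ p)%E by [].
apply/idP/idP => [Ix|Ix].
  rewrite xE -[leLHS](_ : ((I `^ p^-1) `^ p)%E = _); last first.
    by rewrite -poweRrM mulVf// poweRe1.
  apply: gt0_ler_poweR; rewrite ?(ltW p0)// in_itv/= ?leey ?andbT ?lee_fin//.
  exact: poweR_ge0.
rewrite -[leRHS](_ : ((x `^ p)%:E `^ p^-1)%E = _); last first.
  by rewrite poweR_EFin -powRrM mulfV// powRr1.
by apply: gt0_ler_poweR; rewrite ?invr_ge0 ?(ltW p0)// in_itv/= ?leey ?andbT ?lee_fin ?powR_ge0.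
Qed.

Lemma mean_norm_le_bound f x : measurable_fun [set: T] f -> 0 <= x ->
  (forall t, D t -> 0 <= f t <= x) -> (mean_norm D f <= x%:E)%E.
Proof.
move=> mf x0 fx; rewrite mean_norm_leP//.
apply: le_trans (@le_integral_powR D f (cst x) mD mf _ fx) _ => //.
by rewrite /= integral_cst// muD -EFinM.
Qed.

Lemma mean_norm_sum (I : eqType) (s : seq I) (f : I -> T -> R) :
  (forall i, measurable_fun [set: T] (f i)) -> (forall i t, 0 <= f i t) ->
  (mean_norm D (fun t => \sum_(i <- s) f i t)%R <= \sum_(i <- s) mean_norm D (f i))%E.
Proof.
move=> mf f0; elim: s => [|i s IH].
  rewrite big_nil; apply: mean_norm_le_bound => //.
    by under eq_fun do rewrite big_nil; exact: measurable_cst.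
  by move=> t _; rewrite big_nil lexx.
rewrite big_cons; under [X in mean_norm _ X]eq_fun do rewrite big_cons.
apply: le_trans (mean_normD _ _ _ _) _ => //.
- exact: measurable_sum.
- by move=> t; rewrite sumr_ge0.
- exact: leeD2l.
Qed.

End finite_domain.
End mean_norm.

(** * The Besicovitch seminorm *)

Section trigonometric_polynomials.
Variables (R : realType) (G : topologicalZmodType).
Local Notation C := (R[i]^o).
Implicit Types P Q : G -> C.

Lemma trig_poly0 : trig_poly (fun _ : G => 0 : C).
Proof.
exists 0%N, (fun=> 0), (fun _ _ => 1); split; first by case.
by move=> t; rewrite big_ord0.
Qed.

Lemma trig_polyD P Q : trig_poly P -> trig_poly Q ->
  trig_poly (fun t => P t + Q t : C).
Proof.
move=> [n [c [chi [chiP PE]]]] [m [b [psi [psiP QE]]]].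
exists (n + m)%N, (fun i => match fintype.split i with inl j => c j | inr j => b j end),
  (fun i => match fintype.split i with inl j => chi j | inr j => psi j end).
split=> [i|t]; first by case: (fintype.split i).
rewrite PE QE big_split_ord/=; congr (_ + _); apply: eq_bigr => i _.
  by rewrite (unsplitK (inl i)).
by rewrite (unsplitK (inr i)).
Qed.

Lemma trig_polyZ a P : trig_poly P -> trig_poly (fun t => a * P t : C).
Proof.
move=> [n [c [chi [chiP PE]]]]; exists n, (fun i => a * c i), chi; split=> // t.
by rewrite PE mulr_sumr; apply: eq_bigr => i _; rewrite mulrA.
Qed.

Lemma trig_polyB P Q : trig_poly P -> trig_poly Q ->
  trig_poly (fun t => P t - Q t : C).
Proof.
move=> tP /(trig_polyZ (-1)) tQ; have := trig_polyD tP tQ.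
by congr trig_poly; apply/funext => t; rewrite mulN1r.
Qed.

Lemma trig_poly_cmeasurable P : trig_poly P ->
  measurable_fun [set: borel G] (P : borel G -> borel C).
Proof.
move=> [n [c [chi [chiP PE]]]].
have -> : P = fun t => \sum_(i < n) c i * chi i t by exact/funext.
elim: (index_enum _) => [|i s IH].
  by under eq_fun do rewrite big_nil; exact: measurable_cst.
under eq_fun do rewrite big_cons /=.
apply: cmeasurableD => //; apply: cmeasurableZ.
by apply: continuous_cmeasurable; have [] := chiP i.
Qed.

Lemma trig_poly_bounded P : trig_poly P ->
  exists2 M, 0 <= M & forall t, normc (P t) <= M.
Proof.
move=> [n [c [chi [chiP PE]]]]; exists (\sum_(i < n) normc (c i)).
  by rewrite sumr_ge0// => i _; exact: normc_ge0.
move=> t; rewrite PE; elim/big_ind2 : _ => [|x a y b xa yb|i _].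
- by rewrite ComplexField.Normc.normc0.
- by rewrite (le_trans (normcD _ _))// lerD.
- have [_ chi1 _] := chiP i.
  by rewrite ComplexField.Normc.normcM chi1 mulr1.
Qed.

End trigonometric_polynomials.

Section besicovitch_seminorm.
Variables (R : realType) (G : topologicalZmodType).
Hypothesis hausdorffG : hausdorff_space G.
Variable mu : {measure set (borel G) -> \bar R}.
Hypothesis haar_mu : haar_measure mu.
Variables (A : (set G)^nat) (p : R).
Hypotheses (folA : folner mu A) (p1 : 1 <= p).
Local Notation C := (R[i]^o).
Implicit Types f g P : G -> C.
Local Notation cmeasurable f := (measurable_fun [set: borel G] (f : borel G -> borel C)).
Local Notation bes f := (bes_norm mu p A f).
Local Notation mean n f := (mean_norm mu p (A n : set (borel G)) (fun t => normc (f t))).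

Lemma folner_bmeasurable n : measurable (A n : set (borel G)).
Proof. by case: folA. Qed.
Let mA := folner_bmeasurable.

Lemma folner_finite n : exists2 a, 0 < a & mu (A n) = a%:E.
Proof.
case: folA => _ /(_ n) pA /(_ n) A0 _.
have [a a0 aE] := haar_finite (haar_precompact hausdorffG haar_mu (mA n) pA).
by exists a => //; rewrite -lte_fin -aE.
Qed.

Lemma bes_normE f : bes f = limn_esup (fun n => mean n f).
Proof. by []. Qed.

Lemma eq_bes_norm f g : (forall t, normc (f t) = normc (g t)) -> bes f = bes g.
Proof.
by move=> /funext fg; rewrite !bes_normE fg.
Qed.

Lemma bes_norm_ge0 f : (0 <= bes f)%E.
Proof. by apply: limn_esup_ge0 => n; exact: poweR_ge0. Qed.

Lemma bes_normD f g : cmeasurable f -> cmeasurable g ->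
  (bes (fun t => f t + g t)%R <= bes f + bes g)%E.
Proof.
move=> mf mg.
apply: le_trans (limn_esupD_le (u := fun n => mean n f) (v := fun n => mean n g) _ _);
  [|by move=> n; exact: poweR_ge0..].
apply: le_limn_esup; apply: nearW => n.
have [a a0 aE] := folner_finite n.
have mnf := cmeasurable_normc mf; have mng := cmeasurable_normc mg.
apply: le_trans (mean_normD p1 (mA n) aE a0 mnf mng _ _); last 2 first.
- by move=> t; exact: normc_ge0.
- by move=> t; exact: normc_ge0.
apply: (le_mean_norm p1 (mA n) aE a0).
- by apply: cmeasurable_normc; exact: cmeasurableD.
- exact: measurable_funD.
- by move=> t _; rewrite normc_ge0 normcD.
Qed.

Lemma bes_normZ a f : cmeasurable f ->
  bes (fun t => a * f t)%R = ((normc a)%:E * bes f)%E.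
Proof.
move=> mf; rewrite !bes_normE -limn_esupZ; [|exact: normc_ge0|by move=> n; exact: poweR_ge0].
congr (limn_esup _); apply/funext => n.
have [x x0 xE] := folner_finite n.
transitivity (mean_norm mu p (A n : set (borel G)) (fun t => normc a * normc (f t))).
  congr (mean_norm _ _ _ _); apply/funext => t; exact: ComplexField.Normc.normcM.
rewrite (mean_normZ p1 (mA n) xE x0)//.
- exact: cmeasurable_normc.
- by move=> t; exact: normc_ge0.
- exact: normc_ge0.
Qed.

Lemma bes_norm_subC f g : bes (fun t => f t - g t) = bes (fun t => g t - f t).
Proof.
apply: eq_bes_norm => t; exact: normc_distC.
Qed.

Lemma bes_norm_triangle f g h : cmeasurable f -> cmeasurable g -> cmeasurable h ->
  (bes (fun t => (f t - h t)%R) <=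
   bes (fun t => (f t - g t)%R) + bes (fun t => (g t - h t)%R))%E.
Proof.
move=> mf mg mh; rewrite [X in bes X](_ : _ = fun t => (f t - g t) + (g t - h t)).
  by apply: bes_normD; exact: cmeasurableB.
by apply/funext => t; rewrite subrKA.
Qed.

Lemma bes_norm_bounded f M : cmeasurable f -> 0 <= M ->
  (forall t, normc (f t) <= M) -> (bes f <= M%:E)%E.
Proof.
move=> mf M0 fM; apply: limn_esup_le_near; apply: nearW => n.
have [a a0 aE] := folner_finite n.
apply: (mean_norm_le_bound p1 (mA n) aE a0) => //.
  exact: cmeasurable_normc.
by move=> t _; rewrite normc_ge0 fM.
Qed.

Lemma Lp_loc_bounded f : cmeasurable f ->
  (forall K, compact K -> exists M, forall t, K t -> normc (f t) <= M) ->
  Lp_loc mu p f.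
Proof.
move=> mf bf; split=> // K cK; have [M fM] := bf K cK.
have mK := compact_bmeasurable hausdorffG cK.
have [k k0 kE] := haar_finite (haar_compact haar_mu cK).
apply: (@le_lt_trans _ _ (\int[mu]_(t in (K : set (borel G))) (M `^ p)%:E)%E).
  apply: (@le_integral_powR _ _ _ mu p p1 K (fun t => normc (f t)) (cst M)) => //.
    exact: cmeasurable_normc.
  by move=> t Kt; rewrite normc_ge0 fM.
by rewrite integral_cst// [X in (_ * X)%E]kE -EFinM ltry.
Qed.

Lemma Lp_locD f g : Lp_loc mu p f -> Lp_loc mu p g ->
  Lp_loc mu p (fun t => f t + g t).
Proof.
move=> [mf fK] [mg gK]; split; first exact: cmeasurableD.
move=> K cK; have mK := compact_bmeasurable hausdorffG cK.
have mnf := cmeasurable_normc mf; have mng := cmeasurable_normc mg.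
have nf0 t : 0 <= normc (f t) by exact: normc_ge0.
have ng0 t : 0 <= normc (g t) by exact: normc_ge0.
apply: le_lt_trans (integral_powRD_lty p1 mK mnf mng nf0 ng0 (fK _ cK) (gK _ cK)).
apply: (@le_integral_powR _ _ _ mu p p1 K (fun t => normc (f t + g t))
  (fun t => normc (f t) + normc (g t))) => //.
- by apply: cmeasurable_normc; exact: cmeasurableD.
- exact: measurable_funD.
- by move=> t _; rewrite normc_ge0 normcD.
Qed.

Lemma Lp_locZ a f : Lp_loc mu p f -> Lp_loc mu p (fun t => a * f t).
Proof.
move=> [mf fK]; split; first exact: cmeasurableZ.
move=> K cK; have mK := compact_bmeasurable hausdorffG cK.
rewrite (_ : (\int[mu]_(t in _) _)%E =
    (\int[mu]_(t in (K : set (borel G))) ((normc a * normc (f t)) `^ p)%:E)%E).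
  rewrite integral_powRZ//; last 3 first.
  - exact: cmeasurable_normc.
  - by move=> t; exact: normc_ge0.
  - exact: normc_ge0.
  by rewrite lte_mul_pinfty// ?lee_fin ?powR_ge0// fK.
by apply: eq_integral => t _; rewrite ComplexField.Normc.normcM.
Qed.

Lemma trig_poly_Lp_loc P : trig_poly P -> Lp_loc mu p P.
Proof.
move=> tP; apply: Lp_loc_bounded; first exact: trig_poly_cmeasurable.
by move=> K _; have [M _ PM] := trig_poly_bounded tP; exists M.
Qed.

Lemma trig_poly_bes_lty P : trig_poly P -> (bes P < +oo)%E.
Proof.
move=> tP; have [M M0 PM] := trig_poly_bounded tP.
apply: le_lt_trans (bes_norm_bounded (trig_poly_cmeasurable tP) M0 PM) _.
exact: ltry.
Qed.

Lemma ap_bes_cmeasurable f : ap_bes mu p A f -> cmeasurable f.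
Proof. by case=> -[]. Qed.

Lemma trig_poly_ap_bes P : trig_poly P -> ap_bes mu p A P.
Proof.
move=> tP; split; first exact: trig_poly_Lp_loc.
move=> e e0; exists P => //; apply: (@le_lt_trans _ _ 0%E); last by rewrite lte_fin.
apply: bes_norm_bounded => //.
- by apply: cmeasurableB; exact: trig_poly_cmeasurable.
- by move=> t; rewrite subrr ComplexField.Normc.normc0.
Qed.

Lemma ap_besD f g : ap_bes mu p A f -> ap_bes mu p A g ->
  ap_bes mu p A (fun t => f t + g t).
Proof.
move=> Af Ag; split; first by apply: Lp_locD; [case: Af|case: Ag].
move=> e e0; have e2 : 0 < e / 2 by rewrite divr_gt0.
have [P tP fP] := Af.2 _ e2; have [Q tQ gQ] := Ag.2 _ e2.
exists (fun t => P t + Q t); first exact: trig_polyD.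
rewrite [X in bes X](_ : _ = fun t => (f t - P t) + (g t - Q t)); last first.
  by apply/funext => t; rewrite opprD addrACA.
apply: le_lt_trans (bes_normD _ _) _.
- by apply: cmeasurableB; [exact: ap_bes_cmeasurable|exact: trig_poly_cmeasurable].
- by apply: cmeasurableB; [exact: ap_bes_cmeasurable|exact: trig_poly_cmeasurable].
- by rewrite [e]splitr EFinD; exact: lteD fP gQ.
Qed.

Lemma ap_besZ a f : ap_bes mu p A f -> ap_bes mu p A (fun t => a * f t).
Proof.
move=> Af; split; first by apply: Lp_locZ; case: Af.
move=> e e0; have a0 := normc_ge0 a.
(* The [+ 1] covers [a = 0]. *)
have d0 : 0 < e / (normc a + 1) by rewrite divr_gt0// ltr_wpDl.
have [P tP fP] := Af.2 _ d0; exists (fun t => a * P t); first exact: trig_polyZ.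
rewrite [X in bes X](_ : _ = fun t => a * (f t - P t)); last first.
  by apply/funext => t; rewrite mulrBr.
rewrite bes_normZ; last first.
  by apply: cmeasurableB; [exact: ap_bes_cmeasurable|exact: trig_poly_cmeasurable].
apply: le_lt_trans (lee_wpmul2l _ (ltW fP)) _; first by rewrite lee_fin.
rewrite -EFinM lte_fin mulrCA gtr_pMr// ltr_pdivrMr ?mul1r ?ltrDl//.
by rewrite ltr_wpDl.
Qed.

(** Local integrability gives no bound along [A]; finiteness comes from a trigonometric polynomial
    at distance less than 1, which is bounded. *)
Lemma ap_bes_fin_num f : ap_bes mu p A f -> bes f \is a fin_num.
Proof.
move=> Af; rewrite ge0_fin_numE ?bes_norm_ge0//.
have [P tP fP] := Af.2 _ ltr01.
rewrite [X in bes X](_ : _ = fun t => (f t - P t) + P t); last first.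
  by apply/funext => t; rewrite subrK.
apply: le_lt_trans (bes_normD _ _) _.
- by apply: cmeasurableB; [exact: ap_bes_cmeasurable|exact: trig_poly_cmeasurable].
- exact: trig_poly_cmeasurable.
- by apply: lte_add_pinfty; [exact: lt_trans fP (ltry _)|exact: trig_poly_bes_lty].
Qed.

End besicovitch_seminorm.

(** * Completeness *)

Lemma half_geometric_sum_le (R : realType) j m :
  \sum_(j <= k < m) (2^-1 : R) ^+ k <= 2 * 2^-1 ^+ j.
Proof.
have [jm|/ltnW mj] := leqP j m; last first.
  by rewrite big_geq// mulr_ge0// exprn_ge0// invr_ge0.
rewrite (eq_bigr (fun k => - 2 * (2^-1 : R) ^+ k.+1 - - 2 * 2^-1 ^+ k)).
  rewrite (telescope_sumr (fun k => - 2 * (2^-1 : R) ^+ k))// !mulNr opprK.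
  by rewrite addrC lerBlDr lerDl mulr_ge0// exprn_ge0// invr_ge0.
move=> k _; rewrite exprS; lra.
Qed.

Lemma quarter_le_half (R : realType) k : (4^-1 : R) ^+ k <= 2^-1 ^+ k.
Proof. by rewrite lerXn2r// ?nnegrE ?invr_ge0// lef_pV2 ?posrE// ler_nat. Qed.

Lemma normc_telescope (R : realType) (z : nat -> R[i]) j m : (j <= m)%N ->
  normc (z m - z j) <= \sum_(j <= k < m) normc (z k.+1 - z k).
Proof.
move=> jm; rewrite -telescope_sumr//; elim/big_ind2 : _ => //.
- by rewrite ComplexField.Normc.normc0.
- by move=> x a y b xa yb; rewrite (le_trans (normcD _ _))// lerD.
Qed.

Lemma precompactU (T : topologicalType) (X Y : set T) :
  precompact X -> precompact Y -> precompact (X `|` Y).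
Proof.
move=> [X' XX' [cX clX]] [Y' YY' [cY clY]].
exists (X' `|` Y'); first by move=> x [/XX'|/YY']; [left|right].
by split; [exact: compactU|exact: closedU].
Qed.

Lemma bigsetU_precompact (T : topologicalType) (I : Type) (s : seq I)
    (F : I -> set T) :
  (forall i, precompact (F i)) -> precompact (\big[setU/set0]_(i <- s) F i).
Proof.
move=> pF; elim/big_ind : _ => [|X Y|i _]; [|exact: precompactU|exact: pF].
by exists set0 => //; split; [exact: compact0|exact: closed0].
Qed.

(** * Exhaustion of the group by open pre-compact sets *)

Section exhaustion.
Variable G : topologicalZmodType.
Hypothesis locally_compactG : locally_compact [set: G].
Implicit Types K D : set G.

Lemma compact_sub_open_precompact K : compact K ->
  exists D, [/\ open D, precompact D & K `<=` D].
Proof.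
move=> cK.
have nbh (x : G) : exists U : set G, [/\ nbhs x U, compact U & closed U].
  have [U xU [cU clU]] := locally_compactG (I : [set: G] x).
  by exists U; split=> //; move: xU; rewrite withinET.
pose N x := sval (cid (nbh x)).
have NP x : [/\ nbhs x (N x), compact (N x) & closed (N x)].
  by rewrite /N; case: cid.
have : cover_compact (K : set (pointed0 G)) by rewrite -compact_cover.
move=> /(_ (pointed0 G) setT (fun x => (N x)^°))[].
- by move=> x _; exact: open_interior.
- by move=> x _; exists x => //; have [] := NP x.
move=> D _ KD; exists (cover [set` D] (fun x => (N x)^°)); split=> //.
  by apply: bigcup_open => x _; exact: open_interior.
exists (\big[setU/set0]_(x <- enum_fset D) N x).
  move=> y [x xD xy]; rewrite -bigcup_seq; exists x => //.
  exact: interior_subset.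
split.
  by apply: bigsetU_compact => x _; have [] := NP x.
by elim/big_ind : _ => [|U V|x _]; [exact: closed0|exact: closedU|have [] := NP x].
Qed.

(** The compact sets of a sigma-compact group are enlarged to open pre-compact sets [U i]; a compact
    set then has a finite subcover, and the largest index in it works. *)
Lemma precompact_exhaustion : sigma_compact [set: G] ->
  exists D : (set G)^nat, [/\ forall m, open (D m), forall m, precompact (D m),
    forall m n, (m <= n)%N -> D m `<=` D n &
    forall K, compact K -> exists m, K `<=` D m].
Proof.
move=> [K cK GK].
pose U m := sval (cid (compact_sub_open_precompact (cK m))).
have UP m : [/\ open (U m), precompact (U m) & K m `<=` U m].
  by rewrite /U; case: cid.
pose D m := \bigcup_(i in [set i | (i <= m)%N]) U i.
have Dmono m n : (m <= n)%N -> D m `<=` D n.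
  by move=> mn; apply: bigcup_subset => i /= im; exact: leq_trans mn.
exists D; split=> //.
- by move=> m; apply: bigcup_open => i _; have [] := UP i.
- move=> m; rewrite /D (_ : \bigcup_(i in _) U i = \big[setU/set0]_(i < m.+1) U i).
    by apply: bigsetU_precompact => i; have [] := UP i.
  by rewrite -bigcup_mkord.
- move=> L cL.
  have : cover_compact (L : set (pointed0 G)) by rewrite -compact_cover.
  move=> /(_ nat setT U)[].
  + by move=> i _; have [] := UP i.
  + move=> x _; have : [set: G] x by [].
    rewrite GK => -[i _ Kx]; exists i => //; have [_ _] := UP i; exact.
  move=> F _ LF; exists (\max_(i <- enum_fset F) i)%N => x /LF[i iF Ux].
  by exists i => //=; apply: (@leq_bigmax_seq _ _ xpredT id).
Qed.

End exhaustion.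

Section folner_growth.
Variables (R : realType) (G : topologicalZmodType).
Hypothesis hausdorffG : hausdorff_space G.
Variable mu : {measure set (borel G) -> \bar R}.
Hypothesis haar_mu : haar_measure mu.

(** Inner regularity of the open set G supplies a compact set of measure greater than c. *)
Lemma folner_measure_gt (A : (set G)^nat) (c : R) : folner mu A ->
  (c%:E < mu [set: G])%E -> \forall n \near \oo, (c%:E <= mu (A n))%E.
Proof.
move=> folA; case: haar_mu => _ _ _ _ /(_ _ openT) -> /ereal_sup_gt[_ [K [cK _] <-]].
exact: folner_measure_ge.
Qed.

End folner_growth.

Lemma ex_least (Q : nat -> Prop) : (exists n, Q n) ->
  exists2 m, Q m & forall n, Q n -> (m <= n)%N.
Proof.
move=> [n0 Qn0]; have ex : exists n, `[< Q n >] by exists n0; apply/asboolP.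
exists (ex_minn ex); first by case: ex_minnP => m /asboolP.
by move=> n Qn; case: ex_minnP => m _; apply; apply/asboolP.
Qed.

Lemma near_thresholds (Q : nat -> nat -> Prop) :
  (forall k, \forall n \near \oo, Q k n) ->
  exists N : nat -> nat, [/\ forall k n, (N k <= n)%N -> Q k n,
    forall k l, (k <= l)%N -> (N k <= N l)%N & forall k, (k <= N k)%N].
Proof.
move=> Qoo; pose N' k := sval (cid2 (Qoo k)).
have N'P k n : (N' k <= n)%N -> Q k n.
  by rewrite /N'; case: cid2 => /= m _ mQ mn; exact: mQ.
(* Partial sums of [N' i + 1] dominate every [N' k], increase with k and are at least k. *)
exists (fun k => \sum_(i < k.+1) (N' i).+1)%N; split=> [k n|k l kl|k].
- rewrite big_ord_recr/= => h; apply: N'P; apply: leq_trans h.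
  by rewrite (leq_trans (leqnSn _))// leq_addl.
- by rewrite -!(big_mkord xpredT (fun i => (N' i).+1))
    [X in (_ <= X)%N](@big_cat_nat _ _ _ k.+1)//= leq_addr.
- rewrite (leq_trans (leqnSn k))// -[X in (X <= _)%N]card_ord -sum1_card.
  exact: leq_sum.
Qed.

(** * Gluing on a group of infinite volume *)

Section infinite_volume.
Variables (R : realType) (G : topologicalZmodType).
Hypothesis hausdorffG : hausdorff_space G.
Hypothesis locally_compactG : locally_compact [set: G].
Hypothesis sigma_compactG : sigma_compact [set: G].
Variable mu : {measure set (borel G) -> \bar R}.
Hypothesis haar_mu : haar_measure mu.
Variables (A : (set G)^nat) (p : R).
Hypotheses (folA : folner mu A) (p1 : 1 <= p).
Local Notation C := (R[i]^o).
Local Notation cmeasurable f := (measurable_fun [set: borel G] (f : borel G -> borel C)).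
Local Notation bmeasurable X := (measurable (X : set (borel G))).
Local Notation bes f := (bes_norm mu p A f).

Let p0 : 0 < p. Proof. exact: lt_le_trans p1. Qed.

(** A bound X supported on a set of measure b has mean norm at most X (b / a)^(1/p) over a set of
    measure a, hence becomes negligible as a grows. *)
Lemma mean_norm_indic_le (n : nat) (B : set G) (a b X e : R) :
  bmeasurable B -> mu (A n) = a%:E -> 0 < a -> mu B = b%:E -> 0 <= X -> 0 <= e ->
  X `^ p * b <= e `^ p * a ->
  (mean_norm mu p (A n : set (borel G)) (fun t => (X * \1_B t)%R) <= e%:E)%E.
Proof.
move=> mB aE a0 bE X0 e0 Xe; have mA := folner_bmeasurable folA n.
rewrite (mean_norm_leP p1 aE a0)// integral_powRZ//.
have pN0 : p != 0 by rewrite gt_eqF.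
have -> : (\int[mu]_(t in (A n : set (borel G))) (\1_B t `^ p)%:E)%E = mu (B `&` A n).
  rewrite -(integral_indic mu mA mB); apply: eq_integral => t _.
  by rewrite indicE; case: (t \in B); rewrite ?powR1 ?powR0.
apply: (@le_trans _ _ ((X `^ p)%:E * mu B)%E).
  rewrite lee_wpmul2l ?lee_fin ?powR_ge0//.
  by apply: le_measure; [apply: mem_set; exact: measurableI|exact: mem_set|exact: subIsetl].
by rewrite bE -EFinM lee_fin.
Qed.

(** For [n >= N j], let [m] be least with [n < N m]. On [A n] the glued [f] equals [P (l t)] with
    [l t <= m]. If [j <= l t], telescoping bounds |f - P_j| by the sum of [phi k] over j <= k < m,
    each of mean norm below 4^-k over [A n]. If [l t < j], the point lies in [B j], of finite
    measure, where the difference is bounded. *)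
Lemma fast_cvg_infinite (P : nat -> G -> C) :
  mu [set: G] = +oo%E ->
  (forall k, trig_poly (P k)) ->
  (forall k, (bes (fun t => (P k.+1 t - P k t)%R) < (4^-1 ^+ k)%:E)%E) ->
  exists2 f, Lp_loc mu p f &
    forall j, (bes (fun t => (f t - P j t)%R) <= (8 * 2^-1 ^+ j)%:E)%E.
Proof.
move=> muT tP fastP.
have mA := folner_bmeasurable folA.
have mP k : cmeasurable (P k) by exact: trig_poly_cmeasurable.
pose phi k t := normc (P k.+1 t - P k t).
have mphi k : measurable_fun [set: borel G] (phi k : borel G -> R).
  by apply: cmeasurable_normc; exact: cmeasurableB.
have phi0 k t : 0 <= phi k t by exact: normc_ge0.
have [N [NP Nmono Nge]] := near_thresholds (fun k => limn_esup_lt (fastP k)).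
have [D [oD pD Dmono DK]] := precompact_exhaustion locally_compactG sigma_compactG.
(* [A n] belongs to [B m] as soon as [n < N m], that is, before the mean of [phi m] over [A n] is
   known to be small: [f] does not use [P i] on [A n] for any i beyond the first such m. The part
   [D m] makes the [B m] cover G and [f] locally bounded. *)
pose B m : set G := D m `|` \bigcup_(n in [set n | (n < N m)%N]) A n.
have Bmono m n : (m <= n)%N -> B m `<=` B n.
  move=> mn t [Dt|[i /= im At]]; first by left; exact: Dmono Dt.
  by right; exists i => //=; apply: leq_trans im (Nmono _ _ mn).
have mB m : bmeasurable (B m).
  by apply: measurableU; [exact: open_bmeasurable|exact: bigcup_measurable].
have Bfin m : exists2 b, 0 <= b & mu (B m) = b%:E.
  apply/haar_finite/(haar_precompact hausdorffG haar_mu (mB m)).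
  apply: precompactU => //; rewrite bigcup_mkord.
  by apply: bigsetU_precompact => i; case: folA.
have Bcover t : exists m, B m t.
  have [m Dm] := DK _ (@compact_set1 _ t).
  by exists m; left; exact: Dm.
pose l t := sval (cid2 (ex_least (Bcover t))).
have lB t : B (l t) t by rewrite /l; case: cid2.
have l_le t m : B m t -> (l t <= m)%N.
  by rewrite /l; case: cid2 => /= i _; exact.
pose f t : C := P (l t) t.
have mf : cmeasurable f.
  move=> _ Y mY; rewrite setTI.
  rewrite (_ : _ @^-1` _ = \bigcup_m
      ((B m `\` \bigcup_(i in [set i | (i < m)%N]) B i) `&` P m @^-1` Y)).
    apply: bigcup_measurable => m _; apply: measurableI.
      by apply: measurableD => //; exact: bigcup_measurable.
    by have := mP m measurableT _ mY; rewrite setTI.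
  apply/seteqP; split=> [t /= Yt|t [m _ [[Bt nB] /= Yt]]].
    exists (l t) => //; split=> //; split=> // -[i /= il Bi].
    by have := l_le _ _ Bi; rewrite leqNgt il.
  rewrite /f; suff -> : l t = m by [].
  apply/eqP; rewrite eqn_leq l_le//= leqNgt; apply/negP => lm.
  by apply: nB; exists (l t).
pose M k := sval (cid2 (trig_poly_bounded (tP k))).
have M0 k : 0 <= M k by rewrite /M; case: cid2.
have PM k t : normc (P k t) <= M k by rewrite /M; case: cid2.
pose S m := \sum_(i < m.+1) M i.
have S0 m : 0 <= S m by rewrite sumr_ge0.
have MS i m : (i <= m)%N -> M i <= S m.
  move=> im; have im' : (i < m.+1)%N by [].
  by rewrite /S (bigD1 (Ordinal im'))//= lerDl sumr_ge0.
exists f.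
  apply: Lp_loc_bounded => // K cK; have [m Km] := DK _ cK.
  exists (S m) => t Kt; apply: le_trans (PM _ _) _; apply: MS.
  by apply: l_le; left; exact: Km.
move=> j; apply: limn_esup_le_near.
pose e : R := 2^-1 ^+ j.
have e0 : 0 < e by rewrite exprn_gt0// invr_gt0.
(* [S j] bounds every [P i] with i <= j, so X bounds |f - P_j| wherever [l t < j]. *)
pose X := 2 * S j.
have X0 : 0 <= X by rewrite mulr_ge0.
have [b b0 bE] := Bfin j.
have : \forall n \near \oo, ((X `^ p * b / e `^ p)%:E <= mu (A n))%E.
  by apply: (folner_measure_gt hausdorffG haar_mu folA); rewrite muT ltry.
have : \forall n \near \oo, (N j <= n)%N by exists (N j).
apply: filterS2 => n Nn large.
have [a a0 aE] := folner_finite hausdorffG haar_mu folA n.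
(* By minimality [N k <= n] for every k < m, so the estimates on the means of these [phi k] hold at
   this very n. *)
have [m nm mmin] : exists2 m, (n < N m)%N & forall i, (n < N i)%N -> (m <= i)%N.
  by apply: ex_least; exists n.+1.
have jm : (j <= m)%N.
  rewrite leqNgt; apply/negP => mj.
  by have := leq_trans nm (leq_trans (Nmono _ _ (ltnW mj)) Nn); rewrite ltnn.
have mX : measurable_fun [set: borel G] (fun t : borel G => X * \1_(B j) t).
  by apply: measurable_funM => //; exact: measurable_indic.
have XB0 (t : G) : 0 <= X * \1_(B j) t by rewrite mulr_ge0.
have msum : measurable_fun [set: borel G]
    (fun t : borel G => \sum_(k <- index_iota j m) phi k t) by exact: measurable_sum.
have sum0 (t : G) : 0 <= \sum_(k <- index_iota j m) phi k t by rewrite sumr_ge0.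
apply: (@le_trans _ _ (mean_norm mu p (A n : set (borel G))
    (fun t => \sum_(k <- index_iota j m) phi k t + X * \1_(B j) t)%R)).
  apply: (le_mean_norm p1 (mA n) aE a0).
  - by apply: cmeasurable_normc; exact: cmeasurableB.
  - exact: measurable_funD.
  - move=> t At; rewrite normc_ge0/=.
    have lm : (l t <= m)%N by apply: l_le; right; exists n.
    have [jl|lj] := leqP j (l t).
      apply: (@le_trans _ _ (\sum_(j <= k < m) phi k t)); last by rewrite lerDl.
      apply: le_trans (normc_telescope (fun k => P k t) jl) _.
      by rewrite (@big_cat_nat _ _ _ (l t) j m)//= lerDl sumr_ge0.
    rewrite indicE mem_set ?mulr1; last exact: (Bmono _ _ (ltnW lj)).
    apply: ler_wpDl => //; apply: le_trans (normcD _ _) _; rewrite normcN /X.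
    rewrite mulr2n mulrDl mul1r lerD//; apply: le_trans (PM _ _) _; apply: MS => //.
    exact: ltnW.
apply: le_trans (mean_normD p1 (mA n) aE a0 msum mX sum0 XB0) _.
(* The geometric sum needs only 2e of the 7e; the constant 8 is shared with the finite-volume case,
   where it arises as 4 * 2. *)
rewrite (_ : 8 * _ = 7 * e + e); last by rewrite /e; lra.
rewrite EFinD leeD//; last first.
  apply: (mean_norm_indic_le (mB j) aE a0 bE X0 (ltW e0)).
  by move: large; rewrite aE lee_fin ler_pdivrMr ?powR_gt0// [a * _]mulrC.
apply: le_trans (mean_norm_sum p1 (mA n) aE a0 _ mphi phi0) _.
apply: (@le_trans _ _ (\sum_(j <= k < m) (2^-1 ^+ k)%:E)%E).
  rewrite big_nat [leRHS]big_nat; apply: lee_sum => k /andP[jk km].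
  apply: (@le_trans _ _ (4^-1 ^+ k)%:E); last by rewrite lee_fin quarter_le_half.
  apply/ltW/NP; rewrite leqNgt; apply/negP => /mmin.
  by rewrite leqNgt km.
rewrite sumEFin lee_fin (le_trans (half_geometric_sum_le _ _ _))// -/e.
by rewrite ler_wpM2r ?(ltW e0)// ler_nat.
Qed.

End infinite_volume.

(* The limit when z converges, but measurable in a parameter without any
   convergence assumption. *)
Definition limsup_complex (R : realType) (z : nat -> R[i]) : R[i] :=
  (fine (limn_esup (fun k => (Re (z k))%:E)) +i*
   fine (limn_esup (fun k => (Im (z k))%:E)))%C.

Lemma fast_real_limsup (R : realType) (x r : nat -> R) :
  (forall j m, (j <= m)%N -> `|x m - x j| <= r j) -> r @ \oo --> 0 ->
  x @ \oo --> fine (limn_esup (fun k => (x k)%:E)).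
Proof.
move=> xr r0.
have cx : cauchy (x @ \oo).
  apply: cauchy_exP => e e0.
  have [j _ rj] : \forall j \near \oo, `|0 - r j| < e.
    by move/cvgrPdist_lt : r0; exact.
  exists (x j); exists j => // m /= jm; rewrite /ball/= distrC.
  apply: le_lt_trans (xr _ _ jm) _; have := rj j (leqnn j).
  by rewrite sub0r normrN; exact: le_lt_trans (ler_norm _).
have /cvg_ex[y xy] : cvg (x @ \oo) by exact: cauchy_cvg.
have /cvg_limn_einf_sup[_ ->] : (fun k => (x k)%:E) @ \oo --> y%:E.
  by apply: cvg_EFin => //; exact: nearW.
exact: xy.
Qed.

(** Let m tend to infinity in the bound on |z_m - z_j|: the inequality is closed, so the rate [r j]
    passes to the limit unchanged. *)
Lemma fast_complex_limsup (R : realType) (z : nat -> R[i]) (r : nat -> R) :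
  (forall j m, (j <= m)%N -> normc (z m - z j) <= r j) -> r @ \oo --> 0 ->
  forall j, normc (limsup_complex z - z j) <= r j.
Proof.
move=> zr r0 j.
have xP : (fun k => Re (z k)) @ \oo --> Re (limsup_complex z).
  apply: fast_real_limsup r0 => i m im; apply: le_trans (zr _ _ im).
  by rewrite -raddfB; exact: normc_Re.
have yP : (fun k => Im (z k)) @ \oo --> Im (limsup_complex z).
  apply: fast_real_limsup r0 => i m im; apply: le_trans (zr _ _ im).
  by rewrite -raddfB; exact: normc_Im.
apply/ler_addgt0Pr => e e0; have e2 : 0 < e / 2 by rewrite divr_gt0.
have xe : \forall m \near \oo, `|Re (limsup_complex z) - Re (z m)| < e / 2.
  by move/cvgrPdist_lt : xP; exact.
have ye : \forall m \near \oo, `|Im (limsup_complex z) - Im (z m)| < e / 2.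
  by move/cvgrPdist_lt : yP; exact.
have jm : \forall m \near \oo, (j <= m)%N by exists j.
have [m [[/ltW xm /ltW ym] jm']] := filter_ex (filterI (filterI xe ye) jm).
rewrite -(subrKA (z m)) (le_trans (normcD _ _))// addrC lerD ?zr//.
rewrite (le_trans (normc_le_ReIm _))// [e]splitr !raddfB/= lerD//.
Qed.

(** * Pointwise limits on a group of finite volume *)

Section finite_volume.
Variables (R : realType) (G : topologicalZmodType).
Hypothesis hausdorffG : hausdorff_space G.
Variable mu : {measure set (borel G) -> \bar R}.
Hypothesis haar_mu : haar_measure mu.
Variables (A : (set G)^nat) (p : R).
Hypotheses (folA : folner mu A) (p1 : 1 <= p).
Local Notation C := (R[i]^o).
Local Notation cmeasurable f := (measurable_fun [set: borel G] (f : borel G -> borel C)).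
Local Notation bes f := (bes_norm mu p A f).

Let p0 : 0 < p. Proof. exact: lt_le_trans p1. Qed.

(* The limsup along A controls the integral over all of G since the Haar
   measure of the complement of A n tends to 0. *)
Lemma trig_poly_integral_le (P : G -> C) (g e : R) :
  mu [set: G] = g%:E -> trig_poly P -> 0 <= e -> (bes P < e%:E)%E ->
  (\int[mu]_t (normc (P t) `^ p)%:E <= (e `^ p * g)%:E)%E.
Proof.
move=> gE tP e0 Pe; have mP := trig_poly_cmeasurable tP.
have mA := folner_bmeasurable folA.
have mnP := cmeasurable_normc mP.
have [M M0 PM] := trig_poly_bounded tP.
apply/lee_addgt0Pr => d d0.
have Mp0 : 0 < M `^ p + 1 by rewrite ltr_wpDl// powR_ge0.
(* Off [A n] the integrand is at most [M ^ p], eventually on a set of measure at most d / (M^p + 1),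
   so it contributes at most d; the [+ 1] covers [M = 0]. *)
have c0 : 0 < d / (M `^ p + 1) by rewrite divr_gt0.
have : \forall n \near \oo, ((g - d / (M `^ p + 1))%:E <= mu (A n))%E.
  by apply: (folner_measure_gt hausdorffG haar_mu folA); rewrite gE lte_fin ltrBlDr ltrDl.
have := limn_esup_lt Pe => Pen /(filterI Pen)/filter_ex[n [/ltW Pn]].
have [a a0 aE] := folner_finite hausdorffG haar_mu folA n.
rewrite aE lee_fin => ga.
move: Pn; rewrite -[X in (X <= _)%E]/(mean_norm mu p (A n : set (borel G)) (fun t => normc (P t))).
rewrite (mean_norm_leP p1 aE a0)// => Pn.
have mnA : measurable (~` A n : set (borel G)) by exact: measurableC.
have CAE : mu (~` A n) = (g - a)%:E.
  have := measure_setDI mu (measurableT : measurable [set: borel G]) (mA n).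
  rewrite setTI setTD gE aE.
  have [x _ ->] : exists2 x, 0 <= x & mu (~` A n) = x%:E.
    apply: haar_finite; apply: (@le_lt_trans _ _ (mu [set: G])); last by rewrite gE ltry.
    by apply: le_measure; [exact: mem_set|exact: mem_set|].
  by rewrite -EFinD => -[->]; rewrite addrK.
have CA : (\int[mu]_(t in ~` (A n : set (borel G))) (normc (P t) `^ p)%:E <=
    (M `^ p * (g - a))%:E)%E.
  apply: le_trans (@le_integral_powR _ _ _ mu p p1 (~` A n) (fun t => normc (P t))
    (cst M) mnA mnP _ _) _ => //.
    by move=> t _; rewrite normc_ge0 PM.
  by rewrite /= integral_cst// [X in (_ * X)%E]CAE.
rewrite -(setUv (A n : set (borel G))) ge0_integral_setU//; last 3 first.
- exact: measurable_powR_comp.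
- by move=> t _; rewrite lee_fin powR_ge0.
- by apply/disj_setPCl.
apply: le_trans (leeD Pn CA) _; rewrite -!EFinD lee_fin.
have ag : a <= g.
  by rewrite -lee_fin -aE -gE; apply: le_measure; [exact: mem_set|exact: mem_set|].
have h1 : e `^ p * a <= e `^ p * g by rewrite ler_wpM2l// powR_ge0.
rewrite lerD// (@le_trans _ _ ((M `^ p + 1) * (g - a)))//.
  by rewrite ler_wpM2r ?subr_ge0// lerDl.
by rewrite mulrC -ler_pdivlMr//; lra.
Qed.

Lemma fast_cvg_finite (P : nat -> G -> C) :
  (mu [set: G] < +oo)%E ->
  (forall k, trig_poly (P k)) ->
  (forall k, (bes (fun t => (P k.+1 t - P k t)%R) < (4^-1 ^+ k)%:E)%E) ->
  exists2 f, Lp_loc mu p f &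
    forall j, (bes (fun t => (f t - P j t)%R) <= (8 * 2^-1 ^+ j)%:E)%E.
Proof.
move=> /haar_finite[g g0 gE] tP fastP.
have {}g0 : 0 < g.
  rewrite lt_neqAle g0 andbT eq_sym; apply/eqP => g0'.
  by case: haar_mu => /eqP + _ _ _ _; rewrite gE g0'.
have mA := folner_bmeasurable folA.
have mP k : cmeasurable (P k) by exact: trig_poly_cmeasurable.
pose phi k t := normc (P k.+1 t - P k t).
have mphi k : measurable_fun [set: borel G] (phi k : borel G -> R).
  by apply: cmeasurable_normc; exact: cmeasurableB.
have phi0 k t : 0 <= phi k t by exact: normc_ge0.
have pw0 (x : R) : (0 <= (x `^ p)%:E)%E by rewrite lee_fin powR_ge0.
(* The sum S of the (2 ^ k phi_k) ^ p is integrable, and |f - P_j| ^ p is at most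
   (2 * 2 ^- j) ^ p * S everywhere, so no almost-everywhere argument is needed. *)
pose s k (t : borel G) : \bar R := ((2 ^+ k * phi k t) `^ p)%:E.
have ms k : measurable_fun [set: borel G] (s k).
  by apply: measurable_powR_comp; exact: measurable_funM.
pose S t := (\sum_(0 <= k <oo) s k t)%E.
have mS : measurable_fun [set: borel G] S.
  apply: (@emeasurable_fun_cvg _ _ _ _ (fun n t => \sum_(0 <= k < n) s k t)%E).
    by move=> n; exact: emeasurable_sum.
  by move=> t _; apply: is_cvg_nneseries => n _ _; exact: pw0.
have S0 t : (0 <= S t)%E by apply: nneseries_ge0 => k _ _; exact: pw0.
have intS : (\int[mu]_t S t <= (2 * g)%:E)%E.
  rewrite integral_nneseries//; last by move=> k t _; exact: pw0.
  apply: lime_le.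
    apply: is_cvg_nneseries => n _ _; apply: integral_ge0 => t _; exact: pw0.
  (* The integral of [s k] is at most (2^k 4^-k)^p g = (2^-k)^p g, and (2^-k)^p <= 2^-k because p >=
     1. *)
  apply: nearW => n; apply: (@le_trans _ _ (\sum_(0 <= k < n) (2^-1 ^+ k * g)%:E)%E).
    apply: lee_sum => k _; rewrite /s integral_powRZ//.
    have tphi : trig_poly (fun t => P k.+1 t - P k t) by exact: trig_polyB.
    have e0 : 0 <= 4^-1 ^+ k :> R by rewrite exprn_ge0// invr_ge0.
    apply: le_trans (lee_wpmul2l _ (trig_poly_integral_le gE tphi e0 (fastP k))) _ => //.
    rewrite -EFinM lee_fin mulrA -powRM ?exprn_ge0// -exprMn.
    rewrite ler_wpM2r ?(ltW g0)// (_ : 2 * 4^-1 = 2^-1); last by lra.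
    apply: ge1r_powR => //; rewrite exprn_gt0 ?invr_gt0//= exprn_ile1 ?invr_ge0//.
    by rewrite invf_le1// ler1n.
  rewrite sumEFin lee_fin -mulr_suml ler_wpM2r ?(ltW g0)//.
  by have := half_geometric_sum_le R 0 n; rewrite expr0 mulr1.
pose f t : C := limsup_complex (fun k => P k t).
have mf : cmeasurable f.
  have mlim (h : nat -> borel G -> R) : (forall k, measurable_fun setT (h k)) ->
      measurable_fun setT (fun t => fine (limn_esup (fun k => (h k t)%:E))).
    move=> mh; apply: (measurableT_comp (@fine_measurable R setT measurableT)).
    by apply: measurable_fun_limn_esup => k; exact/measurable_EFinP.
  apply/cmeasurableP; split; apply: mlim => k; have /cmeasurableP[] := mP k => //.
have fP j t : ((normc (f t - P j t) `^ p)%:E <= ((2 * 2^-1 ^+ j) `^ p)%:E * S t)%E.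
  have ej0 : 0 < 2 * (2^-1 : R) ^+ j by rewrite mulr_gt0// exprn_gt0// invr_gt0.
  (* Where [S t] is infinite the bound is vacuous, whatever value [limsup_complex] takes. Elsewhere
     S t = b^p dominates each term, so [phi k t <= b 2^-k] and the sequence converges
     geometrically. *)
  have := S0 t; case SE : (S t) => [c| |]// c0; last first.
    by rewrite gt0_muley ?leey// lte_fin powR_gt0.
  rewrite lee_fin in c0.
  pose b := c `^ p^-1.
  have b0 : 0 <= b by exact: powR_ge0.
  have bE : b `^ p = c by rewrite -powRrM mulVf ?powRr1// gt_eqF.
  have phib k : phi k t <= b * 2^-1 ^+ k.
    have : (s k t <= c%:E)%E.
      rewrite -SE; apply: le_trans (nneseries_lim_ge (P := xpredT) (m := 0%N) k.+1 _).
        by rewrite big_nat_recr//= leeDr//; apply: sume_ge0 => i _; exact: pw0.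
      by move=> i _ _; exact: pw0.
    rewrite lee_fin => /(ge0_ler_powR (_ : 0 <= p^-1)).
    rewrite invr_ge0 !nnegrE => /(_ (ltW p0) (powR_ge0 _ _) c0).
    rewrite -powRrM mulfV ?gt_eqF// powRr1 ?mulr_ge0 ?exprn_ge0// -/b => kb.
    by rewrite exprVn ler_pdivlMr ?exprn_gt0// mulrC.
  have dist i m : (i <= m)%N -> normc (P m t - P i t) <= b * (2 * 2^-1 ^+ i).
    move=> im; apply: le_trans (normc_telescope (fun k => P k t) im) _.
    apply: (@le_trans _ _ (\sum_(i <= k < m) b * 2^-1 ^+ k)).
      by apply: ler_sum => k _; exact: phib.
    by rewrite -mulr_sumr ler_wpM2l// half_geometric_sum_le.
  have cv0 : (fun i => b * (2 * 2^-1 ^+ i)) @ \oo --> (0 : R).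
    rewrite (_ : (fun _ => _) = geometric (b * 2) 2^-1).
      by apply: cvg_geometric; rewrite ger0_norm// invf_lt1// ltr1n.
    by apply/funext => i; rewrite /geometric/= mulrA.
  have fb : normc (f t - P j t) <= b * (2 * 2^-1 ^+ j).
    exact: (fast_complex_limsup dist cv0).
  rewrite -EFinM lee_fin -bE -powRM ?(ltW ej0)// [_ * b]mulrC.
  rewrite ge0_ler_powR ?nnegrE ?(ltW p0) ?normc_ge0//.
  by rewrite mulr_ge0// ltW.
have mfP j : measurable_fun [set: borel G] (fun t : borel G => normc (f t - P j t)).
  by apply: cmeasurable_normc; exact: cmeasurableB.
have intfP j : (\int[mu]_t (normc (f t - P j t) `^ p)%:E <=
    ((2 * 2^-1 ^+ j) `^ p * (2 * g))%:E)%E.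
  apply: (@le_trans _ _ (\int[mu]_t (((2 * 2^-1 ^+ j) `^ p)%:E * S t))%E).
    apply: ge0_le_integral => //.
    - exact: measurable_powR_comp.
    - exact: measurable_funeM.
  by rewrite ge0_integralZl_EFin ?powR_ge0// EFinM lee_wpmul2l.
have intfPD (D : set (borel G)) j : measurable D ->
    (\int[mu]_(t in D) (normc (f t - P j t) `^ p)%:E <=
      ((2 * 2^-1 ^+ j) `^ p * (2 * g))%:E)%E.
  move=> mD; apply: le_trans (intfP j); apply: ge0_subset_integral => //.
  exact: measurable_powR_comp.
exists f.
  rewrite (_ : f = fun t => (f t - P 0%N t) + P 0%N t); last first.
    by apply/funext => t; rewrite subrK.
  apply: (Lp_locD hausdorffG p1); last exact: (trig_poly_Lp_loc hausdorffG haar_mu).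
  split; first exact: cmeasurableB.
  move=> K /(compact_bmeasurable hausdorffG) mK.
  by apply: le_lt_trans (intfPD _ 0%N mK) _; exact: ltry.
move=> j; apply: limn_esup_le_near.
(* Half of the volume is enough: with a = |A_n| >= g / 2, the factor 2g is at most 4a <= 4^p a,
   which costs a factor 4 in the norm. *)
have : \forall n \near \oo, ((g / 2)%:E <= mu (A n))%E.
  by apply: (folner_measure_gt hausdorffG haar_mu folA); rewrite gE lte_fin ltr_pdivrMr//; lra.
apply: filterS => n; have [a a0 aE] := folner_finite hausdorffG haar_mu folA n.
move=> ga; have {}ga : g / 2 <= a by rewrite -lee_fin -aE.
rewrite -[X in (X <= _)%E]/(mean_norm mu p (A n : set (borel G))
  (fun t => normc (f t - P j t))).
have ej0 : 0 <= 2 * (2^-1 : R) ^+ j by rewrite mulr_ge0// exprn_ge0// invr_ge0.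
rewrite (_ : 8 * _ = 4 * (2 * 2^-1 ^+ j)); last by lra.
rewrite (mean_norm_leP p1 aE a0) ?mulr_ge0//.
apply: le_trans (intfPD _ j (mA n)) _; rewrite lee_fin.
rewrite (powRM _ (_ : 0 <= 4) ej0)// [4 `^ p * _]mulrC -mulrA.
rewrite ler_wpM2l ?powR_ge0// (@le_trans _ _ (4 * a))//; first by lra.
by rewrite ler_pM2r// le1r_powR// ler1n.
Qed.

End finite_volume.

(** * The Banach space of a complete seminorm *)

(** The laws are required on [S] only, because [fine (bes_norm f)] reflects the seminorm only where
    the latter is finite. *)
Record seminorm_on (R : realType) (W : lmodType R[i]) (S : set W) (N : W -> R)
    : Prop := SeminormOn {
  seminorm0 : S 0;
  seminormD : forall f g, S f -> S g -> S (f + g);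
  seminormZ : forall a f, S f -> S (a *: f);
  seminorm_triangle : forall f g, S f -> S g -> N (f + g) <= N f + N g;
  seminorm_scale : forall a f, S f -> N (a *: f) = ComplexField.Normc.normc a * N f
}.

(** The classes enter as a parameter [cls], so that the quotient built from them is literally the
    carrier [ap_bes_quot]. *)
Definition kernel_class (R : realType) (W : lmodType R[i]) (S : set W)
    (N : W -> R) (cls : W -> set W) :=
  forall f, S f -> cls f = [set g | S g /\ N (f - g) = 0].

(** With [SN] and [clsE] as parameters of the type, the algebraic and normed instances, whose laws
    rest on them, can be attached to it. *)
Definition seminorm_quot (R : realType) (W : lmodType R[i]) (S : set W)
    (N : W -> R) (cls : W -> set W)
    (SN : seminorm_on S N) (clsE : kernel_class S N cls) : Type :=
  set_type [set cls f | f in S].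

Section seminorm_quotient.
Variables (R : realType) (W : lmodType R[i]) (S : set W) (N : W -> R).
Variable cls : W -> set W.
Hypotheses (SN : seminorm_on S N) (clsE : kernel_class S N cls).
Local Notation Q := (seminorm_quot SN clsE).

Let S0 := seminorm0 SN.
Let SD := @seminormD _ _ _ _ SN.
Let SZ := @seminormZ _ _ _ _ SN.

Let SNn f : S f -> S (- f). Proof. by rewrite -scaleN1r => /SZ. Qed.
Let SB f g : S f -> S g -> S (f - g). Proof. by move=> Sf /SNn; exact: SD. Qed.

Let N0 : N 0 = 0.
Proof.
by have := seminorm_scale SN 0 S0; rewrite scale0r ComplexField.Normc.normc0 mul0r.
Qed.

Let NN f : S f -> N (- f) = N f.
Proof.
move=> Sf; rewrite -scaleN1r (seminorm_scale SN)//.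
by rewrite /= oppr0 sqrrN expr1n expr0n addr0 sqrtr1 mul1r.
Qed.

Let N_ge0 f : S f -> 0 <= N f.
Proof.
move=> Sf; have := seminorm_triangle SN Sf (SNn Sf).
by rewrite subrr N0 NN// -mulr2n pmulrn_lge0.
Qed.

Let in_quot f : S f -> [set cls f | f in S] (cls f).
Proof. by exists f. Qed.

Definition quot_class (f : W) : Q :=
  match pselect (S f) with
  | left Sf => SigSub (mem_set (in_quot Sf))
  | right _ => SigSub (mem_set (in_quot S0))
  end.

Lemma quot_classE f : S f -> sval (quot_class f) = cls f.
Proof. by move=> Sf; rewrite /quot_class; case: pselect. Qed.

Definition quot_rep (x : Q) : W := sval (cid2 (set_mem (valP x))).

Lemma quot_repS x : S (quot_rep x).
Proof. by rewrite /quot_rep; case: cid2. Qed.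

Lemma quot_repK x : quot_class (quot_rep x) = x.
Proof.
apply: val_inj; rewrite /= quot_classE; last exact: quot_repS.
by rewrite /quot_rep; case: cid2.
Qed.

Lemma quot_classP f g : S f -> S g ->
  quot_class f = quot_class g <-> N (f - g) = 0.
Proof.
move=> Sf Sg; split=> [/(congr1 (fun x => sval x))|fg0].
  rewrite !quot_classE// (clsE Sf) (clsE Sg) => /seteqP[_ /(_ g)].
  by case=> //; split=> //; rewrite subrr.
apply: val_inj; rewrite /= !quot_classE// (clsE Sf) (clsE Sg).
have tri a b c : S a -> S b -> S c -> N (a - b) = 0 -> N (b - c) = 0 ->
    N (a - c) = 0.
  move=> Sa Sb Sc ab bc; apply/eqP; rewrite eq_le N_ge0 ?andbT; last exact: SB.
  have := seminorm_triangle SN (SB Sa Sb) (SB Sb Sc).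
  by rewrite addrA subrK ab bc addr0.
have gf0 : N (g - f) = 0 by rewrite -opprB NN//; exact: SB.
by apply/seteqP; split=> h [Sh h0]; split=> //; [exact: (tri _ f)|exact: (tri _ g)].
Qed.

Lemma quot_class_rep f : S f -> N (quot_rep (quot_class f) - f) = 0.
Proof.
by move=> Sf; apply/quot_classP => //; [exact: quot_repS|rewrite quot_repK].
Qed.

HB.instance Definition _ := gen_eqMixin Q.
HB.instance Definition _ := gen_choiceMixin Q.

(** The operations are computed on chosen representatives; [quot_addE], [quot_scaleE], [quot_oppE]
    and [quot_normE] show that the choice does not matter, and most laws then reduce to those of [W]
    through [quotW]. *)
Definition quot_add (x y : Q) : Q := quot_class (quot_rep x + quot_rep y).
Definition quot_opp (x : Q) : Q := quot_class (- quot_rep x).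
Definition quot_scale (a : R[i]) (x : Q) : Q := quot_class (a *: quot_rep x).
Definition quot_norm (x : Q) : R[i] := (N (quot_rep x))%:C.

Lemma seminorm_eq0D f g : S f -> S g -> N f = 0 -> N g = 0 -> N (f + g) = 0.
Proof.
move=> Sf Sg f0 g0; apply/eqP; rewrite eq_le N_ge0 ?andbT; last exact: SD.
by rewrite (le_trans (seminorm_triangle SN Sf Sg))// f0 g0 addr0.
Qed.

Lemma quot_addE f g : S f -> S g ->
  quot_add (quot_class f) (quot_class g) = quot_class (f + g).
Proof.
move=> Sf Sg; apply/quot_classP; [|exact: SD|].
  by apply: SD; exact: quot_repS.
rewrite opprD addrACA; apply: seminorm_eq0D; rewrite ?quot_class_rep//.
  by apply: SB => //; exact: quot_repS.
by apply: SB => //; exact: quot_repS.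
Qed.

Lemma quot_scaleE a f : S f ->
  quot_scale a (quot_class f) = quot_class (a *: f).
Proof.
move=> Sf; apply/quot_classP; [|exact: SZ|].
  by apply: SZ; exact: quot_repS.
rewrite -scalerBr (seminorm_scale SN) ?quot_class_rep ?mulr0//.
by apply: SB => //; exact: quot_repS.
Qed.

Lemma quot_oppE f : S f -> quot_opp (quot_class f) = quot_class (- f).
Proof.
move=> Sf; rewrite -scaleN1r -quot_scaleE// /quot_scale scaleN1r//.
Qed.

Lemma quot_normE f : S f -> quot_norm (quot_class f) = (N f)%:C.
Proof.
move=> Sf; rewrite /quot_norm; congr (_%:C).
have le a b : S a -> S b -> N (a - b) = 0 -> N a <= N b.
  move=> Sa Sb ab0; have := seminorm_triangle SN (SB Sa Sb) Sb.
  by rewrite subrK ab0 add0r.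
have Sr := quot_repS (quot_class f).
apply/eqP; rewrite eq_le !le// ?quot_class_rep//.
by rewrite -opprB NN ?quot_class_rep//; exact: SB.
Qed.

Let quotW (P : Q -> Prop) : (forall f, S f -> P (quot_class f)) -> forall x, P x.
Proof. by move=> PS x; rewrite -(quot_repK x); apply: PS; exact: quot_repS. Qed.

Lemma quot_addA : associative quot_add.
Proof.
elim/quotW => f Sf; elim/quotW => g Sg; elim/quotW => h Sh.
by rewrite !quot_addE ?addrA//; exact: SD.
Qed.

Lemma quot_addC : commutative quot_add.
Proof. by move=> x y; rewrite /quot_add addrC. Qed.

Lemma quot_add0 : left_id (quot_class 0) quot_add.
Proof. by elim/quotW => f Sf; rewrite quot_addE ?add0r. Qed.

Lemma quot_addN : left_inverse (quot_class 0) quot_opp quot_add.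
Proof.
by elim/quotW => f Sf; rewrite quot_oppE// quot_addE ?addNr//; exact: SNn.
Qed.

HB.instance Definition _ := GRing.isZmodule.Build Q
  quot_addA quot_addC quot_add0 quot_addN.

Lemma quot_scaleA a b (x : Q) :
  quot_scale a (quot_scale b x) = quot_scale (a * b) x.
Proof.
elim/quotW: x => f Sf.
by rewrite !quot_scaleE ?scalerA//; exact: SZ.
Qed.

Lemma quot_scale1 : left_id 1 quot_scale.
Proof. by elim/quotW => f Sf; rewrite quot_scaleE ?scale1r. Qed.

Lemma quot_scaleDr : right_distributive quot_scale +%R.
Proof.
move=> a; elim/quotW => f Sf; elim/quotW => g Sg.
rewrite [in LHS]/GRing.add/= quot_addE// !quot_scaleE// ?scalerDr//; last exact: SD.
by rewrite [in RHS]/GRing.add/= quot_addE//; exact: SZ.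
Qed.

Lemma quot_scaleDl (x : Q) : {morph quot_scale^~ x : a b / a + b}.
Proof.
move=> a b; elim/quotW: x => f Sf; rewrite !quot_scaleE// scalerDl.
by rewrite [in RHS]/GRing.add/= quot_addE//; exact: SZ.
Qed.

HB.instance Definition _ := GRing.Zmodule_isLmodule.Build R[i] Q
  quot_scaleA quot_scale1 quot_scaleDr quot_scaleDl.

Lemma quot_normD (x y : Q) : quot_norm (x + y) <= quot_norm x + quot_norm y.
Proof.
elim/quotW: x => f Sf; elim/quotW: y => g Sg.
rewrite [in leLHS]/GRing.add/= quot_addE// !quot_normE//; last exact: SD.
by rewrite -rmorphD/= lecR; exact: (seminorm_triangle SN).
Qed.

Lemma quot_normZ (a : R[i]) (x : Q) : quot_norm (a *: x) = `|a| * quot_norm x.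
Proof.
elim/quotW: x => f Sf.
rewrite [in LHS]/GRing.scale/= quot_scaleE// !quot_normE//; last exact: SZ.
by rewrite (seminorm_scale SN)// rmorphM.
Qed.

Lemma quot_norm_eq0 (x : Q) : quot_norm x = 0 -> x = 0.
Proof.
elim/quotW: x => f Sf; rewrite quot_normE// => -[f0].
by apply/quot_classP; rewrite ?subr0.
Qed.

HB.instance Definition _ := Lmodule_isNormed.Build R[i] Q
  quot_normD quot_normZ quot_norm_eq0.


Lemma quot_distE f g : S f -> S g ->
  `|quot_class f - quot_class g| = (N (f - g))%:C :> R[i].
Proof.
move=> Sf Sg; rewrite -quot_normE; last exact: SB.
rewrite [in LHS]/GRing.opp/= quot_oppE// [in LHS]/GRing.add/= quot_addE//.
exact: SNn.
Qed.

Hypothesis fast_cauchy_cvg : forall u : nat -> W, (forall k, S (u k)) ->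
  (forall k, N (u k.+1 - u k) < 4^-1 ^+ k.+1) ->
  exists2 f, S f & forall e, 0 < e -> \forall k \near \oo, N (f - u k) < e.

(** A Cauchy filter contains a ball of radius [r k] for each k. Consecutive balls meet, since both
    belong to the filter, so their centres form a fast Cauchy sequence, and the limit of the centres
    is a limit of the filter. *)
Lemma quot_complete (F : set_system Q) : ProperFilter F -> cauchy F -> cvg F.
Proof.
move=> FF cF.
(* The exponent leaves room: r_k + r_(k+1) = (5/4) r_k < 4 r_k = 4^-(k+1), the rate required of the
   centres. *)
pose r k : R := 4^-1 ^+ k.+2.
have r_gt0 k : 0 < r k by rewrite exprn_gt0// invr_gt0.
have hx k : exists x : Q, F (ball x (r k)%:C).
  by move/cauchyP : cF; apply; rewrite ltcR.
pose x k := sval (cid (hx k)).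
have Fx k : F (ball (x k) (r k)%:C) by rewrite /x; case: cid.
pose u k := quot_rep (x k).
have Su k : S (u k) by exact: quot_repS.
have xE k : x k = quot_class (u k) by rewrite quot_repK.
have [k|f Sf fu] := fast_cauchy_cvg Su.
  have [z [zk zk1]] := filter_ex (filterI (Fx k) (Fx k.+1)).
  rewrite -ltcR -quot_distE// -!xE.
  rewrite -(subrKA z) (le_lt_trans (ler_normD _ _))//.
  move: zk zk1; rewrite -!ball_normE/= => zk zk1.
  rewrite (@lt_trans _ _ ((r k.+1)%:C + (r k)%:C))//; first by rewrite ltrD// distrC.
  rewrite -rmorphD/= ltcR (_ : r k.+1 = 4^-1 * r k); last by rewrite /r exprS.
  rewrite (_ : 4^-1 ^+ k.+1 = 4 * r k); last by rewrite /r [in RHS]exprS mulVKf.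
  by have := r_gt0 k; lra.
apply: (cvgP (quot_class f)).
apply/cvgrPdist_lt => e e0.
have eE : e = (complex.Re e)%:C by rewrite RRe_real// gtr0_real.
have e0' : 0 < complex.Re e / 2 by rewrite divr_gt0// -ltcR -eE.
have [k [/= fk rk]] : exists k, N (f - u k) < complex.Re e / 2 /\ r k < complex.Re e / 2.
  apply: (@filter_ex _ \oo); apply: filterI; first exact: fu.
  have : (fun k => r k) @ \oo --> (0 : R).
    rewrite (_ : r = geometric (4^-1 ^+ 2) 4^-1).
      by apply: cvg_geometric; rewrite ger0_norm// invf_lt1// ltr1n.
    by apply/funext => k; rewrite /r /geometric/= -exprD add2n.
  by move=> /cvgrPdist_lt/(_ _ e0'); apply: filterS => k; rewrite sub0r normrN gtr0_norm.
apply: filterS (Fx k) => z; rewrite -ball_normE/= => zk.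
rewrite -(subrKA (x k)) (le_lt_trans (ler_normD _ _))// eE.
rewrite [X in X%:C]splitr rmorphD/= ltrD//; last by rewrite (lt_trans zk)// ltcR.
by rewrite xE quot_distE// ltcR.
Qed.

HB.instance Definition _ := Uniform_isComplete.Build Q quot_complete.

Lemma seminorm_quot_banach :
  exists c : CompleteNormedModule.axioms_ R[i] (set_type [set cls f | f in S]),
    let V := CompleteNormedModule.Pack c : completeNormedModType R[i] in
    [/\ forall (x y : V) f g, sval x f -> sval y g -> sval (x + y : V) (f + g),
        forall a (x : V) f, sval x f -> sval (a *: x : V) (a *: f)
      & forall (x : V) f, sval x f -> S f /\ `|x| = (N f)%:C].
Proof.
(* [Q] unfolds to the set type in the goal, so its structure is a structure on that type itself. *)
exists (CompleteNormedModule.class Q) => /=.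
have memP (x : Q) f : sval x f -> S f /\ x = quot_class f.
  elim/quotW: x => g Sg; rewrite quot_classE// (clsE Sg) => -[Sf fg].
  by split=> //; apply/quot_classP.
have mem f : S f -> sval (quot_class f) f.
  by move=> Sf; rewrite quot_classE// (clsE Sf)/= subrr N0.
split.
- move=> x y f g /memP[Sf ->] /memP[Sg ->].
  by rewrite [X in sval X]/GRing.add/= quot_addE//; exact/mem/SD.
- move=> a x f /memP[Sf ->].
  by rewrite [X in sval X]/GRing.scale/= quot_scaleE//; exact/mem/SZ.
- by move=> x f /memP[Sf ->]; split=> //; exact: quot_normE.
Qed.

End seminorm_quotient.

Lemma fine_subadditive (R : realType) (x y z : \bar R) :
  x \is a fin_num -> y \is a fin_num -> z \is a fin_num ->
  (z <= x + y)%E -> fine z <= fine x + fine y.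
Proof. by case: x y z => [x| |] [y| |] [z| |]. Qed.

(** * Completeness of the Besicovitch seminorm *)

Section besicovitch_complete.
Variables (R : realType) (G : topologicalZmodType).
Hypothesis hausdorffG : hausdorff_space G.
Hypothesis locally_compactG : locally_compact [set: G].
Hypothesis sigma_compactG : sigma_compact [set: G].
Variable mu : {measure set (borel G) -> \bar R}.
Hypothesis haar_mu : haar_measure mu.
Variables (A : (set G)^nat) (p : R).
Hypotheses (folA : folner mu A) (p1 : 1 <= p).
Local Notation C := (R[i]^o).
Local Notation cmeasurable f := (measurable_fun [set: borel G] (f : borel G -> borel C)).
Local Notation bes f := (bes_norm mu p A f).
Local Notation fbes := (fun f : G -> C => fine (bes_norm mu p A f)).

Let triangle f g h : cmeasurable f -> cmeasurable g -> cmeasurable h ->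
  (bes (fun t => (f t - h t)%R) <=
   bes (fun t => (f t - g t)%R) + bes (fun t => (g t - h t)%R))%E.
Proof. exact: (bes_norm_triangle hausdorffG haar_mu folA p1). Qed.

Let ap_besB f g : ap_bes mu p A f -> ap_bes mu p A g ->
  ap_bes mu p A (fun t => f t - g t).
Proof.
move=> Af /(ap_besZ hausdorffG haar_mu folA p1 (-1)) Ag.
have := ap_besD hausdorffG haar_mu folA p1 Af Ag.
by congr ap_bes; apply/funext => t; rewrite mulN1r.
Qed.

Let fbesK f : ap_bes mu p A f -> (fbes f)%:E = bes f.
Proof. by move=> Af; rewrite fineK// (ap_bes_fin_num hausdorffG haar_mu folA p1). Qed.

Let fbes_ltP f e : ap_bes mu p A f -> (bes f < e%:E)%E <-> fbes f < e.
Proof. by move=> Af; rewrite -(fbesK Af) lte_fin. Qed.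

Lemma trig_poly_fast_cvg (P : nat -> G -> C) :
  (forall k, trig_poly (P k)) ->
  (forall k, (bes (fun t => (P k.+1 t - P k t)%R) < (4^-1 ^+ k)%:E)%E) ->
  exists2 f, Lp_loc mu p f &
    forall j, (bes (fun t => (f t - P j t)%R) <= (8 * 2^-1 ^+ j)%:E)%E.
Proof.
have [|] := ltP (mu [set: G]) +oo%E; first exact: fast_cvg_finite.
by rewrite leye_eq => /eqP; exact: fast_cvg_infinite.
Qed.

Lemma ap_bes_fast_cvg (u : nat -> G -> C) :
  (forall k, ap_bes mu p A (u k)) ->
  (forall k, fbes (fun t => u k.+1 t - u k t) < 4^-1 ^+ k.+1) ->
  exists2 f, ap_bes mu p A f &
    forall e, 0 < e -> \forall k \near \oo, fbes (fun t => f t - u k t) < e.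
Proof.
move=> Au fastu.
pose r k : R := 4^-1 ^+ k.
have r0 k : 0 < r k by rewrite exprn_gt0// invr_gt0.
have rS k : r k.+1 = r k / 4 by rewrite /r exprS mulrC.
have mu_ k : cmeasurable (u k) by exact: ap_bes_cmeasurable (Au k).
(* Tolerance 4^-(k+1): the distance from P_(k+1) to P_k is then below 4^-(k+2) + 4^-(k+1) +
   4^-(k+1), which is 9/16 of 4^-k. *)
pose P k := sval (cid2 ((Au k).2 _ (r0 k.+1))).
have tP k : trig_poly (P k) by rewrite /P; case: cid2.
have uP k : (bes (fun t => (u k t - P k t)%R) < (r k.+1)%:E)%E.
  by rewrite /P; case: cid2.
have mP k : cmeasurable (P k) by exact: trig_poly_cmeasurable.
have [|f Lf fP] := trig_poly_fast_cvg tP.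
  move=> k; rewrite -[_ ^+ k]/(r k).
  apply: le_lt_trans (triangle (mP k.+1) (mu_ k.+1) (mP k)) _.
  have le2 := triangle (mu_ k.+1) (mu_ k) (mP k).
  apply: le_lt_trans (leeD2l _ le2) _.
  have u1 : (bes (fun t => (u k.+1 t - u k t)%R) < (r k.+1)%:E)%E.
    exact/(fbes_ltP _ (ap_besB (Au k.+1) (Au k))).
  rewrite (bes_norm_subC _ _ _ (P k.+1)).
  apply: lt_le_trans (lteD (uP k.+1) (lteD u1 (uP k))) _.
  rewrite -!EFinD lee_fin !rS; have := r0 k; lra.
have mf : cmeasurable f by case: Lf.
have cv0 : (fun k => 8 * 2^-1 ^+ k) @ \oo --> (0 : R).
  by apply: cvg_geometric; rewrite ger0_norm// invf_lt1// ltr1n.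
have small e : 0 < e -> \forall k \near \oo, 8 * (2^-1 : R) ^+ k < e.
  move=> e0; move/cvgrPdist_lt : cv0 => /(_ _ e0).
  apply: filterS => k; rewrite sub0r normrN; exact: le_lt_trans (ler_norm _).
have Af : ap_bes mu p A f.
  split=> // e e0; have [k ke] := filter_ex (small e e0).
  by exists (P k) => //; apply: le_lt_trans (fP k) _; rewrite lte_fin.
exists f => // e e0; have e2 : 0 < e / 2 by rewrite divr_gt0.
apply: filterS (small _ e2) => k ke.
apply/(fbes_ltP _ (ap_besB Af (Au k))).
apply: le_lt_trans (triangle mf (mP k) (mu_ k)) _.
rewrite (bes_norm_subC _ _ _ (P k)).
apply: le_lt_trans (leeD (fP k) (ltW (uP k))) _.
rewrite -EFinD lte_fin rS.
have := quarter_le_half R k; rewrite -[4^-1 ^+ k]/(r k).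
by have := r0 k; lra.
Qed.

Let besfin f : ap_bes mu p A f -> bes f \is a fin_num.
Proof. exact: (ap_bes_fin_num hausdorffG haar_mu folA p1). Qed.

Let fine_besD f g : ap_bes mu p A f -> ap_bes mu p A g ->
  fine (bes (fun t => f t + g t)%R) <= fine (bes f) + fine (bes g).
Proof.
move=> Af Ag.
have fin_sum := besfin (ap_besD hausdorffG haar_mu folA p1 Af Ag).
have le_sum := bes_normD hausdorffG haar_mu folA p1 (ap_bes_cmeasurable Af)
  (ap_bes_cmeasurable Ag).
exact: (fine_subadditive (besfin Af) (besfin Ag) fin_sum le_sum).
Qed.

Let fine_besZ a f : ap_bes mu p A f ->
  fine (bes (fun t => a * f t)%R) = normc a * fine (bes f).
Proof.
move=> Af.
rewrite (bes_normZ hausdorffG haar_mu folA p1 a (ap_bes_cmeasurable Af)).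
exact: (fineM (isT : (normc a)%:E \is a fin_num) (besfin Af)).
Qed.

Lemma bes_seminorm_on :
  seminorm_on (W := (G -> C : lmodType R[i])) (ap_bes mu p A) fbes.
Proof.
split.
- exact: (trig_poly_ap_bes hausdorffG haar_mu folA p1 (@trig_poly0 R G)).
- by move=> f g; exact: (ap_besD hausdorffG haar_mu folA p1).
- by move=> a f; exact: (ap_besZ hausdorffG haar_mu folA p1).
- exact: fine_besD.
- exact: fine_besZ.
Qed.

(** [fine] also sends infinity to 0, so passing from a vanishing [fine] back to a vanishing seminorm
    uses that f - g is again almost periodic, hence of finite seminorm. *)
Lemma bes_kernel_class :
  kernel_class (W := (G -> C : lmodType R[i])) (ap_bes mu p A) fbes
    (bes_class mu p A).
Proof.
move=> f Af; apply/seteqP; split=> g [Ag fg0]; split=> //.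
  exact: (congr1 fine fg0).
exact: etrans (esym (fbesK (ap_besB Af Ag))) (congr1 EFin fg0).
Qed.

End besicovitch_complete.

Theorem theorem4p9 (R : realType) (G : topologicalZmodType)
    (hausdorffG : hausdorff_space G)
    (locally_compactG : locally_compact [set: G])
    (sigma_compactG : sigma_compact [set: G])
    (theta : {measure set (borel G) -> \bar R})
    (haar_theta : haar_measure theta)
    (A : (set G)^nat) (folnerA : folner theta A)
    (p : R) (p_ge1 : 1 <= p) :
  ap_bes_quot_is_banach theta p A.
Proof.
have [c [cD cZ cN]] := seminorm_quot_banach
  (bes_seminorm_on hausdorffG haar_theta folnerA p_ge1)
  (bes_kernel_class hausdorffG haar_theta folnerA p_ge1)
  (ap_bes_fast_cvg hausdorffG locally_compactG sigma_compactG haar_theta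
     folnerA p_ge1).
exists c; split.
- exact: cD.
- exact: cZ.
- move=> x f xf; have [Af xE] := cN x f xf; split=> //.
  exact: (ap_bes_fin_num hausdorffG haar_theta folnerA p_ge1).
Qed.
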